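(* Let $M$ and $B$ be Riemannian manifolds and let $\pi:M\to B$ be an onto smooth map with maximal rank. Assume that $B$ is compact, and for each $b\in B$ let the fiber $F_b=\pi^{-1}(b)$ be endowed with the metric induced from $(M,d)$. Suppose that there are constants $\alpha\geq 1$ and $\beta>0$, independent of $b$, such that for all $b\in B$ the inequality $$\|v\|_{M}\leq \alpha\|w\|_{B}+\beta$$ holds for all $x\in F_b$ and all $w\in T_bB$, where $v\in (HT)_x\subset T_xM$ is the horizontal lift of $w$ through $x$. Then, for each $b\in B$, the inclusion map $\iota:F_b\hookrightarrow M$ is a rough isometry. In particular, since $B$ is compact, $M$ is roughly isometric to the product $\pi^{-1}(b)\times B$.
   Context: The dimension of $M$ is at least that of $B$. $\pi$ has maximal rank if its derivative $(\pi_{\ast})_x:T_xM\to T_{\pi(x)}B$ is surjective for all $x\in M$. The vertical subspace is $(VT)_x=\ker(\pi_{\ast})_x$ (the vectors tangent to the fiber through $x$), and the horizontal subspace $(HT)_x$ is its orthogonal complement in $T_xM$. For $w\in T_bB$ and $x\in F_b$, the horizontal lift of $w$ through $x$ is the unique $v\in (HT)_x$ with $(\pi_{\ast})_x(v)=w$. $\|\cdot\|_M$ and $\|\cdot\|_B$ are the Riemannian norms on $TM$ and $TB$. Here $d$ is the Riemannian distance of $M$, $B$ carries its Riemannian distance, the induced metric on a fiber is the restriction of $d$ to it, and products carry the product metric. A map $\varphi:(X,\delta)\to(Y,\rho)$ between metric spaces, not necessarily continuous, is a rough isometry if: (1) there are constants $A\geq 1$, $C\geq 0$ such that $\frac{1}{A}\delta(p_1,p_2)-C\leq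 \rho(\varphi(p_1),\varphi(p_2))\leq A\,\delta(p_1,p_2)+C$ for all $p_1,p_2\in X$; and (2) there is $\varepsilon>0$ such that every $q\in Y$ satisfies $\rho(q,\varphi(X))<\varepsilon$. Two metric spaces are roughly isometric if there is a rough isometry between them.
   Formalization: M is additionally assumed complete for its Riemannian distance; without this the claim fails, e.g. for M = {(t,θ) in R×S^1 : θ ≠ θ0 or |t|<1} with the flat metric, projected to B = S^1, where the fiber over θ0 is bounded but M is not. *)

(* Defs.v *)
From HB Require Import structures.
From mathcomp Require Import all_boot all_order all_algebra.
From mathcomp Require Import all_classical all_reals all_analysis.

Set Implicit Arguments.
Unset Strict Implicit.
Unset Printing Implicit Defensive.

Import Order.TTheory GRing.Theory Num.Theory.
Import numFieldNormedType.Exports.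

Local Open Scope classical_set_scope.
Local Open Scope ring_scope.

(* [U] is meant to be open and [V] finite-dimensional; then asking that every
   directional derivative be again of class C^k is the usual notion of C^k. *)
Fixpoint Ck_on (R : realType) (V W : normedModType R) (k : nat) (U : set V)
    (f : V -> W) : Prop :=
  if k is k'.+1 then
    (forall x, U x -> differentiable f x) /\
    (forall v, Ck_on k' U (fun x => 'D_v f x))
  else forall x, U x -> {for x, continuous f}.

Definition smooth_on (R : realType) (V W : normedModType R) (U : set V)
    (f : V -> W) : Prop := forall k, Ck_on k U f.

(* A homeomorphism from the open set [dom] of T onto the open set [img] of R^n.
   [cmap] and [cinv] are total; their values off [dom] and [img] are junk. *)
Record chart (R : realType) (n : nat) (T : topologicalType) := Chart {
  dom : set T;
  img : set 'rV[R]_n;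
  cmap : T -> 'rV[R]_n;
  cinv : 'rV[R]_n -> T;
  dom_open : open dom;
  img_open : open img;
  cmap_img : forall x, dom x -> img (cmap x);
  cinv_dom : forall p, img p -> dom (cinv p);
  cmapK : forall x, dom x -> cinv (cmap x) = x;
  cinvK : forall p, img p -> cmap (cinv p) = p;
  cmap_continuous : forall x, dom x -> {for x, continuous cmap};
  cinv_continuous : forall p, img p -> {for p, continuous cinv} }.

(* [chart_at] singles out one chart around each point; it is used only to
   represent tangent vectors, see [tangent]. *)
Record smoothManifold (R : realType) (n : nat) := SmoothManifold {
  carrier :> topologicalType;
  atlas : set (chart R n carrier);
  chart_at : carrier -> chart R n carrier;
  manifold_hausdorff : hausdorff_space carrier;
  manifold_second_countable : @second_countable carrier;
  chart_at_atlas : forall x, atlas (chart_at x);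
  chart_at_dom : forall x, dom (chart_at x) x;
  atlas_smooth : forall c c', atlas c -> atlas c' ->
    smooth_on (img c `&` cinv c @^-1` dom c') (cmap c' \o cinv c) }.

(* T_x M: a tangent vector at x is represented by its coordinates in the chart
   [chart_at x]. *)
Definition tangent (R : realType) (n : nat) (M : smoothManifold R n)
    (x : M) : Type := 'rV[R]_n.

(* Change of coordinates, from the chart c (around x) to [chart_at x]: the
   tangent vector at x whose coordinates in c are u. *)
Definition coord_vector (R : realType) (n : nat) (M : smoothManifold R n)
    (c : chart R n M) (x : M) (u : 'rV[R]_n) : tangent x :=
  'D_u (cmap (chart_at x) \o cinv c) (cmap c x).

Definition smooth_map (R : realType) (m n : nat) (M : smoothManifold R m)
    (N : smoothManifold R n) (f : M -> N) : Prop :=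
  continuous f /\
  forall c c', atlas c -> atlas c' ->
    smooth_on (img c `&` (f \o cinv c) @^-1` dom c') (cmap c' \o f \o cinv c).

Definition tangent_map (R : realType) (m n : nat) (M : smoothManifold R m)
    (N : smoothManifold R n) (f : M -> N) (x : M) (v : tangent x) :
    tangent (f x) :=
  'D_v (cmap (chart_at (f x)) \o f \o cinv (chart_at x)) (cmap (chart_at x) x).

Definition maximal_rank (R : realType) (m n : nat) (M : smoothManifold R m)
    (N : smoothManifold R n) (f : M -> N) : Prop :=
  forall (x : M) (w : tangent (f x)),
    exists v : tangent x, tangent_map f v = w.

(* Riemannian manifolds are taken connected: this is what makes the infimum in
   [rdist] range over a nonempty set, and [rdist] a genuine metric. *)
Record riemannianManifold (R : realType) (n : nat) := RiemannianManifold {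
  manifold :> smoothManifold R n;
  metric : forall x : manifold, 'rV[R]_n -> 'rV[R]_n -> R;
  metric_linear : forall x a u v w,
    @metric x (a *: u + v) w = a * metric x u w + metric x v w;
  metric_sym : forall x u v, metric x u v = metric x v u;
  metric_pos : forall x v, v != 0 -> 0 < metric x v v;
  metric_smooth : forall (c : chart R n manifold) (u v : 'rV[R]_n), atlas c ->
    smooth_on (W := R^o) (img c) (fun p =>
      metric (cinv c p) (coord_vector c (cinv c p) u)
                        (coord_vector c (cinv c p) v));
  riemannian_connected : connected [set: manifold] }.

Definition tnorm (R : realType) (n : nat) (M : riemannianManifold R n)
    (x : M) (v : tangent x) : R := Num.sqrt (metric x v v).

Definition velocity (R : realType) (n : nat) (M : smoothManifold R n)
    (c : R -> M) (t : R) : tangent (c t) :=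
  derive1 (cmap (chart_at (c t)) \o c) t.

(* A C^1 curve [0, 1] -> M, given with an extension to a neighbourhood of
   [0, 1] so that the derivatives at 0 and 1 are two-sided; every C^1 curve on
   [0, 1] has such an extension. *)
Definition C1_curve (R : realType) (n : nat) (M : smoothManifold R n)
    (c : R -> M) : Prop :=
  forall t, 0 <= t <= 1 ->
    {for t, continuous c} /\
    forall h, atlas h -> dom h (c t) ->
      (\forall s \near t, derivable (cmap h \o c) s 1) /\
      {for t, continuous (derive1 (cmap h \o c))}.

Definition curve_length (R : realType) (n : nat) (M : riemannianManifold R n)
    (c : R -> M) : R :=
  (\int[lebesgue_measure]_(t in `[0, 1]) tnorm (velocity c t))%R.

(* A piecewise C^1 path from x to y is the concatenation of C^1 curves, each of
   them parametrized by [0, 1]; the empty list is the constant path. *)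
Fixpoint piecewise_C1_path (R : realType) (n : nat) (M : smoothManifold R n)
    (x y : M) (cs : seq (R -> M)) : Prop :=
  if cs is c :: cs' then
    [/\ C1_curve c, c 0 = x & piecewise_C1_path (c 1) y cs']
  else x = y.

Definition rdist (R : realType) (n : nat) (M : riemannianManifold R n)
    (x y : M) : R :=
  inf [set \sum_(c <- cs) curve_length c | cs in piecewise_C1_path x y].

Definition fiber (X Y : Type) (f : X -> Y) (b : Y) : Type := {x : X | f x = b}.

Definition vertical (R : realType) (m n : nat) (M : riemannianManifold R m)
    (B : riemannianManifold R n) (pi : M -> B) (x : M) : set (tangent x) :=
  [set u | tangent_map pi u = 0].

Definition horizontal (R : realType) (m n : nat) (M : riemannianManifold R m)
    (B : riemannianManifold R n) (pi : M -> B) (x : M) : set (tangent x) :=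
  [set v | forall u, vertical pi (x := x) u -> metric x u v = 0].

Definition horizontal_lift (R : realType) (m n : nat)
    (M : riemannianManifold R m) (B : riemannianManifold R n) (pi : M -> B)
    (x : M) (w : tangent (pi x)) (v : tangent x) : Prop :=
  horizontal pi v /\ tangent_map pi v = w.

(* The last clause is rho(q, phi(X)) < eps; the infimum is taken in the extended
   reals so that the distance to the empty set is +oo. *)
Definition rough_isometry (R : realType) (X Y : Type) (dX : X -> X -> R)
    (dY : Y -> Y -> R) (phi : X -> Y) : Prop :=
  (exists A C : R, [/\ 1 <= A, 0 <= C &
     forall p1 p2, A^-1 * dX p1 p2 - C <= dY (phi p1) (phi p2)
                                       <= A * dX p1 p2 + C]) /\
  (exists2 eps : R, 0 < eps &
     forall q, (ereal_inf [set (dY q (phi p))%:E | p in [set: X]] < eps%:E)%E).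

Definition roughly_isometric (R : realType) (X Y : Type) (dX : X -> X -> R)
    (dY : Y -> Y -> R) : Prop :=
  exists phi : X -> Y, rough_isometry dX dY phi.

Definition induced_dist (R : realType) (X Y : Type) (f : X -> Y) (b : Y)
    (dX : X -> X -> R) (p q : fiber f b) : R := dX (sval p) (sval q).

(* The l^2 product, as for a product of Riemannian manifolds. *)
Definition prod_dist (R : realType) (X Y : Type) (dX : X -> X -> R)
    (dY : Y -> Y -> R) (p q : X * Y) : R :=
  Num.sqrt (dX p.1 q.1 ^+ 2 + dY p.2 q.2 ^+ 2).

Definition complete_dist (R : realType) (X : Type) (dX : X -> X -> R) : Prop :=
  forall u : nat -> X,
    (forall e : R, 0 < e -> exists N : nat, forall i j : nat,
      (N <= i)%N -> (N <= j)%N -> dX (u i) (u j) < e) ->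
    exists x, forall e : R, 0 < e -> exists N : nat, forall i : nat,
      (N <= i)%N -> dX (u i) x < e.

(* Main.v *)
(* Homogeneity of the horizontal lift removes [beta]: |v| <= alpha |w|. It then
   suffices to bound the distance to [F_b] uniformly, and, [B] being compact and
   connected, to join fibers over nearby points. No lift of a whole path is
   needed for this (hence no differential equation): work in a chart [k] of [B]
   and minimize phi(x) = |k (pi x) - k b|. A short straight segment in a chart
   of [M] along the horizontal lift of the unit vector from k (pi x) to k b
   makes phi decrease at a rate bounded below by a multiple of the distance
   travelled, so completeness of [M] and Caristi's principle give a zero of phi
   at distance controlled by phi. Completeness refers to [rdist], so one also
   proves that [rdist]-convergence implies convergence in the topology of [M]. *)
Require Import Defs.
From HB Require Import structures.
From mathcomp Require Import all_boot all_order all_algebra.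
From mathcomp Require Import all_classical all_reals all_analysis.
From mathcomp Require Import lra.

Set Implicit Arguments.
Unset Strict Implicit.
Unset Printing Implicit Defensive.

Import Order.TTheory GRing.Theory Num.Theory.
Import numFieldNormedType.Exports.

Local Open Scope classical_set_scope.
Local Open Scope ring_scope.

(** The inclusion preserves distances exactly, so only density of [F_b] is at stake. For the
    product, [B] has bounded diameter, so it is enough to move each point of M to a nearby point of
    [F_b] and to keep the second coordinate constant. Since [rdist] is an infimum over paths, an
    upper bound only needs one explicit path, here coordinate segments. Comparing [rdist] with the
    topology instead needs a lower bound on the length of every path. It comes from a test function,
    a truncated coordinate distance, whose growth along a curve is dominated by the speed. A norm
    and a minimum are not differentiable, so this growth is only controlled to the right of each
    time, and the fundamental theorem of calculus is replaced by a Dini-type comparison. *)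

(** * One-sided calculus, uniform bounds by compactness, Caristi's principle *)

Lemma derivable_near_right (R : realType) (V : normedModType R) (f : R -> V)
    (t e : R) : derivable f t 1 -> 0 < e ->
  \forall s \near t^'+, `|f s - f t - (s - t) *: derive1 f t| <= e * (s - t).
Proof.
move=> df e0.
have : (fun h => h^-1 *: (f (h + t) - f t)) @ 0^' --> derive1 f t.
  rewrite derive1E; move: df; rewrite /derivable /derive.
  by under eq_fun do rewrite [_%:A]mulr1.
move=> /cvgrPdist_le /(_ _ e0).
rewrite /dnbhs /within/= => /nbhs_ballP[d /= d0 dF'].
exists d => //= s; rewrite /ball_/= => cs sc.
have sc0 : 0 < s - t by rewrite subr_gt0.
have := dF' (s - t); rewrite /ball/= sub0r normrN distrC cs gt_eqF//.
move=> /(_ isT isT); rewrite subrK distrC => h.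
rewrite -[f s - f t](scalerKV (lt0r_neq0 sc0)) -scalerBr normrZ gtr0_norm//.
by rewrite mulrC ler_pM2r.
Qed.

(* A continuous function that is strictly decreasing to the right of every point
   of [0, 1) attains its minimum over [0, 1] at 1. *)
Lemma dini_le_integral (R : realType) (g K : R -> R) :
  continuous K -> {within `[0, 1], continuous g} ->
  (forall t e : R, 0 <= t < 1 -> 0 < e ->
     \forall s \near t^'+, g s - g t <= (K t + e) * (s - t)) ->
  g 1 - g 0 <= (\int[lebesgue_measure]_(t in `[0, 1]) K t)%R.
Proof.
move=> cK cg gK.
(* Starting the integral at -1 makes 0 an interior point, so [F] has a two-sided derivative on all
   of [0, 1]. *)
pose F (x : R) : R := (\int[lebesgue_measure]_(t in `[- 1, x]) K t)%R.
have iK (a b : R) : lebesgue_measure.-integrable `[a, b] (EFin \o K).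
  apply: continuous_compact_integrable; first exact: segment_compact.
  exact: continuous_subspaceT.
have F' x : -1 < x -> derivable F x 1 /\ derive1 F x = K x.
  move=> x1; apply: (@continuous_FTC1_closed _ K (-1) x (x + 1)) => //.
    by rewrite ltrDl.
  exact: cK.
have -> : (\int[lebesgue_measure]_(t in `[0, 1]) K t)%R = F 1 - F 0.
  rewrite /F Rintegral_itvB ?bnd_simp//; try lra.
  rewrite Rintegral_itv_obnd_cbnd//.
  apply: integrableS (iK 0 1) => //.
  by apply: subset_itvr; rewrite bnd_simp.
apply/ler_addgt0Pr => e e0.
pose H t := g t - F t - e * t.
have cF : {within `[0, 1], continuous F}.
  apply: derivable_within_continuous => x; rewrite in_itv/= => /andP[x0 _].
  by apply: (F' _ _).1; rewrite (lt_le_trans _ x0)//; lra.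
have cH : {within `[0, 1], continuous H}.
  move=> x; apply: cvgB; first by apply: cvgB; [exact: cg|exact: cF].
  apply: continuous_subspaceT; exact: mulrl_continuous.
have [c c01 Hc] := EVT_min ler01 cH.
have [c0 c1] : 0 <= c /\ c <= 1 by move: c01; rewrite in_itv/= => /andP[].
suff c1E : c = 1.
  have := Hc 0; rewrite in_itv/= lexx ler01 => /(_ isT).
  rewrite c1E /H; lra.
apply/eqP; rewrite eq_le c1/= leNgt; apply/negP => {}c1.
have [dF F'c] : derivable F c 1 /\ derive1 F c = K c by apply: F'; lra.
(* One third of the slope [- e] of [H] pays for the estimate on [g], one third for that on [F]; the
   last third keeps [H] strictly decreasing. *)
have e3 : 0 < e / 3 by lra.
have nF : \forall s \near c^'+, (K c - e / 3) * (s - c) <= F s - F c.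
  have := derivable_near_right dF e3; rewrite F'c.
  apply: filterS => s; rewrite ler_norml => /andP[+ _].
  rewrite [_ *: _]mulrC; lra.
have : \forall s \near c^'+, H s < H c.
  have n1 := gK c _ (introT andP (conj c0 c1)) e3.
  near=> s.
  have sc : 0 < s - c by rewrite subr_gt0; near: s; exact: nbhs_right_gt.
  have h1 : (K c - e / 3) * (s - c) <= F s - F c by near: s.
  have h2 : g s - g c <= (K c + e / 3) * (s - c) by near: s.
  have : 0 < e * (s - c) by exact: mulr_gt0.
  rewrite /H; lra.
move=> Hs; near c^'+ => s.
have : H s < H c by near: s.
rewrite ltNge Hc// in_itv/=; apply/andP; split.
  by rewrite (le_trans c0)//; near: s; exact: nbhs_right_ge.
by near: s; exact: nbhs_right_le.
Unshelve. all: by end_near. Qed.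

Lemma compact_unif_bound (T : topologicalType) (R : realType)
    (P : R -> T -> Prop) :
  compact [set: T] -> (forall (K K' : R) x, K <= K' -> P K x -> P K' x) ->
  (forall x : T, exists K : R, \forall y \near x, P K y) ->
  exists K, forall x, P K x.
Proof.
move=> /compact_near_coveringP cT mono locP.
have [M [_ HM]] : \forall K \near (pinfty_nbhs R), [set: T] `<=` P K.
  apply: cT => x _; have [K PK] := locP x.
  near=> y i => /=.
  apply: (@mono K); first by near: i; apply: nbhs_pinfty_ge; rewrite num_real.
  by near: y.
(* The filter at infinity gives the bound only for constants strictly above [M]. *)
by exists (M + 1) => x; apply: HM => //; rewrite ltrDl.
Unshelve. all: by end_near. Qed.

(* The preorder [le] is that of Caristi's fixed point theorem; a greedy
   increasing sequence has a limit, which dominates it and so has [phi] zero. *)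
Lemma caristi (R : realType) (X : Type) (d : X -> X -> R) (S : set X)
    (phi : X -> R) (K : R) :
  (forall x, d x x = 0) -> (forall x y, d x y = d y x) ->
  (forall x y z, d x z <= d x y + d y z) -> (forall x y, 0 <= d x y) ->
  complete_dist d -> 0 < K ->
  (forall x, S x -> 0 <= phi x) ->
  (forall (u : nat -> X) x, (forall i, S (u i)) ->
     (forall i j, (i <= j)%N -> phi (u j) <= phi (u i)) ->
     (forall e, 0 < e -> exists N, forall i, (N <= i)%N -> d (u i) x < e) ->
     S x /\ forall i, phi x <= phi (u i)) ->
  (forall x, S x -> 0 < phi x ->
     exists2 y, S y & phi y < phi x /\ d x y <= K * (phi x - phi y)) ->
  forall x, S x -> exists2 y, S y & phi y = 0 /\ d x y <= K * phi x.
Proof.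
move=> dxx d_sym d_tri d_ge0 d_complete K0 phi0 Sclosed Sstep x0 Sx0.
pose le x y := S y /\ d x y <= K * (phi x - phi y).
have le_tr x y z : le x y -> le y z -> le x z.
  move=> [Sy xy] [Sz yz]; split=> //; apply: (le_trans (d_tri x y z)); lra.
have le_refl x : S x -> le x x by move=> Sx; split=> //; rewrite dxx subrr mulr0.
pose m x := inf [set phi y | y in le x].
have m_lb x y : le x y -> m x <= phi y.
  move=> xy; apply: ge_inf; last by exists y.
  by exists 0 => _ [z [Sz _] <-]; exact: phi0.
(* Greedy choice: at least half of the decrease of [phi] still available above [x] is realised. If
   none is available, [x] itself is chosen. *)
have next x : exists y, S x -> le x y /\ phi y <= (phi x + m x) / 2.
  case: (pselect (S x)) => Sx; last by exists x.
  have mx := m_lb _ _ (le_refl _ Sx).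
  have [E|mx'] : m x = phi x \/ m x < phi x.
    by move: mx; rewrite le_eqVlt => /orP[/eqP|]; [left|right].
    by exists x => _; split; [exact: le_refl|rewrite E; lra].
  have hi : has_inf [set phi y | y in le x].
    split; first by exists (phi x), x => //; exact: le_refl.
    by exists 0 => _ [z [Sz _] <-]; exact: phi0.
  have e0 : 0 < (phi x - m x) / 2 by lra.
  have [_ [y xy <-] yy] := inf_adherent e0 hi.
  by exists y => _; split=> //; rewrite -/(m x) in yy; lra.
pose f x := projT1 (cid (next x)).
have fP x : S x -> le x (f x) /\ phi (f x) <= (phi x + m x) / 2.
  exact: projT2 (cid (next x)).
pose u i := iter i f x0.
have Su i : S (u i) by elim: i => //= i /fP[[]].
have uS i : le (u i) (u i.+1) by exact: (fP _ (Su i)).1.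
have u_le i j : (i <= j)%N -> le (u i) (u j).
  move=> /subnK <-; elim: (j - i)%N => [|k IH]; first exact: le_refl.
  by rewrite addSn; apply: le_tr IH (uS _).
have le_phi x y : le x y -> phi y <= phi x.
  move=> [_ xy]; rewrite -subr_ge0 -(pmulr_rge0 _ K0).
  exact: le_trans xy.
pose l := inf (range (phi \o u)).
have hl : has_inf (range (phi \o u)).
  by split; [exists (phi (u 0%N)), 0%N|exists 0 => _ [i _ <-]; exact: phi0].
have l_lb i : l <= phi (u i) by apply: ge_inf; [case: hl|exists i].
have l_cv e : 0 < e -> exists N, forall i, (N <= i)%N -> phi (u i) < l + e.
  move=> e0; have [_ [N _ <-] HN] := inf_adherent e0 hl.
  by exists N => i /u_le/le_phi Ni; exact: le_lt_trans HN.
(* The sequence is Cauchy because its distances are bounded by [K] times differences of the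
   convergent sequence [phi (u i)]. *)
have [x ux] : exists x, forall e : R, 0 < e -> exists N, forall i, (N <= i)%N ->
    d (u i) x < e.
  apply: d_complete => e e0.
  have eK : 0 < e / K by exact: divr_gt0.
  have [N HN] := l_cv _ eK.
  have H i j : (N <= i)%N -> (i <= j)%N -> d (u i) (u j) < e.
    move=> Ni ij; apply: le_lt_trans (u_le _ _ ij).2 _.
    rewrite mulrC -ltr_pdivlMr//.
    have := HN _ Ni; have := l_lb j; lra.
  exists N => i j Ni Nj; have [ij|/ltnW ij] := leqP i j; first exact: H.
  by rewrite d_sym; exact: H.
have [Sx phix] := Sclosed u x Su (fun i j ij => le_phi _ _ (u_le _ _ ij)) ux.
have u_x i : le (u i) x.
  split=> //; apply/ler_addgt0Pr => e e0; have [N HN] := ux e e0.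
  pose j := maxn N i.
  apply: (le_trans (d_tri _ (u j) _)).
  apply: lerD; last by apply/ltW/HN; exact: leq_maxl.
  apply: (le_trans (u_le i j (leq_maxr _ _)).2).
  by rewrite ler_pM2l// lerB.
have phix0 : phi x = 0.
  apply/eqP; rewrite eq_le phi0// andbT leNgt; apply/negP => px.
  (* Such a [y] lies above every [u N], so [m (u N) <= phi y]. Once
     [phi (u N) < l + (phi x - phi y)], the greedy choice yields
     [phi (u N.+1) < (l + phi x) / 2 <= l], which is absurd. *)
  have [y Sy [yx dxy]] := Sstep _ Sx px.
  have u_y i : le (u i) y by apply: le_tr (u_x i) _; split.
  have e0 : 0 < phi x - phi y by lra.
  have [N HN] := l_cv _ e0.
  have := (fP _ (Su N)).2; rewrite -/(u N.+1).
  have := m_lb _ _ (u_y N); have := HN N (leqnn _).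
  have := phix N.+1; have := phix N; have := l_lb N.+1.
  have lx : phi x <= l.
    apply: lb_le_inf; first by case: hl.
    by move=> _ [i _ <-]; exact: phix.
  have := le_phi _ _ (u_y N.+2); rewrite /u/=; lra.
by exists x => //; split=> //; have := (u_x 0%N).2; rewrite phix0 subr0.
Qed.

(** * Charts *)

Section charts.
Context (R : realType) (n : nat).

Lemma chart_nbhs_dom (T : topologicalType) (h : chart R n T) (x : T) :
  dom h x -> \forall y \near x, dom h y.
Proof. by move=> hx; apply: open_nbhs_nbhs; split=> //; exact: dom_open. Qed.

Lemma chart_nbhs_img (T : topologicalType) (h : chart R n T) (p : 'rV[R]_n) :
  img h p -> \forall q \near p, img h q.
Proof. by move=> hp; apply: open_nbhs_nbhs; split=> //; exact: img_open. Qed.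

Lemma chart_near_cinv (T : topologicalType) (h : chart R n T) (p : 'rV[R]_n)
    (P : set T) :
  img h p -> (\forall y \near cinv h p, P y) -> \forall q \near p, P (cinv h q).
Proof. by move=> hp; exact: (cinv_continuous hp). Qed.

Lemma chart_near_cmap (T : topologicalType) (h : chart R n T) (x : T)
    (P : set 'rV[R]_n) :
  dom h x -> (\forall p \near cmap h x, P p) -> \forall y \near x, P (cmap h y).
Proof. by move=> hx; exact: (cmap_continuous hx). Qed.

(** Closedness is in all of [T], not just in [dom h]: the set is the image under [cinv h] of a
    compact ball, hence compact in a Hausdorff space. This is what controls curves and limits that
    might leave the chart. *)
Lemma chart_ball_closed (T : topologicalType) (h : chart R n T)
    (p : 'rV[R]_n) (r : R) :
  hausdorff_space T -> (forall q, `|q - p| <= r -> img h q) ->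
  closed [set x | dom h x /\ `|cmap h x - p| <= r].
Proof.
move=> hT sub; apply: compact_closed => //.
have -> : [set x | dom h x /\ `|cmap h x - p| <= r] =
    cinv h @` [set q | `|q - p| <= r].
  apply/seteqP; split=> [x [hx xr]|_ [q qr <-]].
    by exists (cmap h x) => //; exact: cmapK.
  by split; [exact/cinv_dom/sub|rewrite cinvK//; exact: sub].
apply: continuous_compact.
  apply: continuous_in_subspaceT => q; rewrite inE => /sub qh.
  exact: cinv_continuous.
have -> : [set q | `|q - p| <= r] = closed_ball_ (@Num.norm _ _) p r.
  by apply/seteqP; split=> q /=; rewrite /closed_ball_/= distrC.
apply: bounded_closed_compact; last exact: closed_closed_ball_.
exists (`|p| + r); split; first exact: num_real.
move=> x px q /=; rewrite /closed_ball_/= => pq.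
rewrite (le_trans _ (ltW px))// -[q](subrK p) (le_trans (ler_normD _ _))//.
by rewrite addrC lerD2l distrC.
Qed.

Section manifold.
Variable M : smoothManifold R n.
Implicit Types (h k : chart R n M) (x : M).

Lemma transition_differentiable h k (p : 'rV[R]_n) :
  atlas h -> atlas k -> img h p -> dom k (cinv h p) ->
  differentiable (cmap k \o cinv h) p.
Proof.
by move=> ah ak hp kp; have [H _] := atlas_smooth ah ak 1%N; apply: H; split.
Qed.

Lemma transition_derive_continuous h k (p v : 'rV[R]_n) :
  atlas h -> atlas k -> img h p -> dom k (cinv h p) ->
  {for p, continuous (fun q => 'D_v (cmap k \o cinv h) q)}.
Proof.
by move=> ah ak hp kp; have [_ H] := atlas_smooth ah ak 1%N; apply: (H v); split.
Qed.

(** Chain rule applied to a composite of transition maps that is the identity near [cmap h x]. *)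
Lemma transitionK h k x : atlas h -> atlas k -> dom h x -> dom k x ->
  forall u, 'd (cmap h \o cinv k) (cmap k x)
              ('d (cmap k \o cinv h) (cmap h x) u) = u.
Proof.
move=> ah ak hx kx u.
have dkh : differentiable (cmap k \o cinv h) (cmap h x).
  by apply: transition_differentiable; rewrite ?cmapK//; exact: cmap_img.
have dhk : differentiable (cmap h \o cinv k) ((cmap k \o cinv h) (cmap h x)).
  by rewrite /= cmapK//; apply: transition_differentiable; rewrite ?cmapK//;
     exact: cmap_img.
have <- : (cmap k \o cinv h) (cmap h x) = cmap k x by rewrite /= cmapK.
rewrite -[LHS]/(('d _ _ \o 'd _ _) u) -diff_comp// -deriveE; last first.
  exact: differentiable_comp.
rewrite (@near_eq_derive _ _ _ _ id) ?derive_id//.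
near=> q.
have hq : img h q by near: q; apply: chart_nbhs_img; exact: cmap_img.
have kq : dom k (cinv h q).
  near: q; apply: chart_near_cinv; first exact: cmap_img.
  by rewrite cmapK//; exact: chart_nbhs_dom.
by rewrite /= cmapK// cinvK.
Unshelve. all: by end_near. Qed.

Lemma coord_vectorE h x u : atlas h -> dom h x ->
  coord_vector h x u = 'd (cmap (chart_at x) \o cinv h) (cmap h x) u :> tangent x.
Proof.
move=> ah hx; rewrite /coord_vector deriveE//.
apply: transition_differentiable; rewrite ?cmapK//.
- exact: chart_at_atlas.
- exact: cmap_img.
- exact: chart_at_dom.
Qed.

Lemma coord_vector_chart_at x u : coord_vector (chart_at x) x u = u :> tangent x.
Proof.
rewrite /coord_vector (@near_eq_derive _ _ _ _ id) ?derive_id//.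
near=> q; rewrite /= cinvK//; near: q; apply: chart_nbhs_img.
exact/cmap_img/chart_at_dom.
Unshelve. all: by end_near. Qed.

(** [velocity] uses the chart at [c t], which jumps with [t]; continuity of the speed can only be
    read in one fixed chart [h]. *)
Lemma velocityE h (c : R -> M) (t : R) : atlas h ->
  (\forall s \near t, dom h (c s)) -> derivable (cmap h \o c) t 1 ->
  velocity c t = coord_vector h (c t) (derive1 (cmap h \o c) t).
Proof.
move=> ah hc dc; have hct : dom h (c t) by exact: nbhs_singleton hc.
rewrite coord_vectorE// /velocity.
have dc' : differentiable (cmap h \o c) t by exact/derivable1_diffP.
have dk : differentiable (cmap (chart_at (c t)) \o cinv h) ((cmap h \o c) t).
  apply: transition_differentiable; rewrite //= ?cmapK//.
  - exact: chart_at_atlas.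
  - exact: cmap_img.
  - exact: chart_at_dom.
rewrite (derive1E' dc') derive1E.
rewrite (@near_eq_derive _ _ _ _
  ((cmap (chart_at (c t)) \o cinv h) \o (cmap h \o c))); last first.
  by near=> s; rewrite /= cmapK//; near: s.
rewrite deriveE; last exact: differentiable_comp.
exact: (congr1 (fun F => F 1) (diff_comp dc' dk)).
Unshelve. all: by end_near. Qed.

End manifold.
End charts.

(** * The metric in coordinates *)

Section riemannian.
Context (R : realType) (n : nat) (M : riemannianManifold R n).
Implicit Types (h : chart R n M) (x : M).

Lemma metric0l x w : metric x 0 w = 0.
Proof.
have := metric_linear x 1 0 0 w; rewrite scaler0 addr0 mul1r.
by move/eqP; rewrite -subr_eq0 opprD addNKr oppr_eq0 => /eqP.
Qed.

Lemma metricZl x a u w : metric x (a *: u) w = a * metric x u w.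
Proof. by rewrite -[a *: u]addr0 metric_linear metric0l addr0. Qed.

Lemma metric_suml x (a : 'I_n -> R) (u : 'I_n -> 'rV[R]_n) w :
  metric x (\sum_i a i *: u i) w = \sum_i a i * metric x (u i) w.
Proof.
elim/big_rec2: _ => [|i b v _ <-]; first exact: metric0l.
by rewrite metric_linear.
Qed.

Lemma metric_sumr x (a : 'I_n -> R) (u : 'I_n -> 'rV[R]_n) w :
  metric x w (\sum_i a i *: u i) = \sum_i a i * metric x w (u i).
Proof.
rewrite Defs.metric_sym metric_suml; apply: eq_bigr => i _.
by rewrite Defs.metric_sym.
Qed.

Lemma tnorm_ge0 x (v : tangent x) : 0 <= tnorm v.
Proof. exact: sqrtr_ge0. Qed.

Lemma tnormZ x (a : R) (v : 'rV[R]_n) :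
  tnorm (a *: v : tangent x) = `|a| * tnorm (v : tangent x).
Proof.
rewrite /tnorm metricZl Defs.metric_sym metricZl mulrA -expr2.
by rewrite sqrtrM ?sqr_ge0// sqrtr_sqr.
Qed.

Definition chart_metric h (p u v : 'rV[R]_n) : R :=
  metric (cinv h p) (coord_vector h (cinv h p) u) (coord_vector h (cinv h p) v).

Lemma coord_vectorZ h x a u : atlas h -> dom h x ->
  coord_vector h x (a *: u) = a *: (coord_vector h x u : 'rV[R]_n).
Proof. by move=> ah hx; rewrite !coord_vectorE// linearZ. Qed.

Lemma chart_metric_delta h (p u v : 'rV[R]_n) : atlas h -> img h p ->
  chart_metric h p u v = \sum_i \sum_j
    u 0 i * (v 0 j * chart_metric h p (delta_mx 0 i) (delta_mx 0 j)).
Proof.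
move=> ah hp; have hx : dom h (cinv h p) by exact: cinv_dom.
have cs w : coord_vector h (cinv h p) w =
    \sum_i w 0 i *: (coord_vector h (cinv h p) (delta_mx 0 i) : 'rV_n).
  rewrite coord_vectorE// [w in LHS]row_sum_delta linear_sum.
  by apply: eq_bigr => i _; rewrite linearZ coord_vectorE.
rewrite {1}/chart_metric cs metric_suml; apply: eq_bigr => i _.
rewrite (cs v) metric_sumr mulr_sumr; exact: eq_bigr.
Qed.

(** [metric_smooth] is about fixed vectors. Expanding in the standard basis reduces joint continuity
    to that of the finitely many coefficients of the metric. *)
Lemma chart_metric_continuous h (T : topologicalType) (p u v : T -> 'rV[R]_n)
    (t : T) : atlas h -> img h (p t) ->
  {for t, continuous p} -> {for t, continuous u} -> {for t, continuous v} ->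
  {for t, continuous (fun s => chart_metric h (p s) (u s) (v s))}.
Proof.
move=> ah hp cp cu cv.
pose F s := \sum_i \sum_j u s 0 i * (v s 0 j *
  chart_metric h (p s) (delta_mx 0 i) (delta_mx 0 j)).
have cF : {for t, continuous F}.
  apply: cvg_big => [|i _]; first exact: add_continuous.
  apply: cvg_big => [|j _]; first exact: add_continuous.
  apply: cvgM; last apply: cvgM.
  - exact: (cvg_comp _ _ cu (@coord_continuous _ _ _ 0 i (u t))).
  - exact: (cvg_comp _ _ cv (@coord_continuous _ _ _ 0 j (v t))).
  - have H : chart_metric h q (delta_mx 0 i) (delta_mx 0 j) @[q --> p t] -->
        chart_metric h (p t) (delta_mx 0 i) (delta_mx 0 j).
      exact: (metric_smooth (delta_mx 0 i) (delta_mx 0 j) ah 0%N _ hp).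
    exact: (cvg_comp _ _ cp H).
rewrite /prop_for /continuous_at chart_metric_delta//; apply: cvg_trans cF; apply: near_eq_cvg.
near=> s; rewrite /F chart_metric_delta//; near: s.
by apply: cp; exact: chart_nbhs_img.
Unshelve. all: by end_near. Qed.

Lemma chart_metric_gt0 h (p u : 'rV[R]_n) : atlas h -> img h p -> u != 0 ->
  0 < chart_metric h p u u.
Proof.
move=> ah hp u0; apply: metric_pos; apply: contra_neq u0 => cu.
have hx : dom h (cinv h p) by exact: cinv_dom.
have <- := transitionK ah (chart_at_atlas (cinv h p)) hx (chart_at_dom _) u.
have E := coord_vectorE u ah hx; rewrite cu in E.
by rewrite -[X in 'd _ _ X]E linear0.
Qed.

(** On the compact unit sphere the metric is bounded above and away from 0, uniformly for base
    points near [p]; homogeneity extends this to all vectors. *)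
Lemma chart_norm_equiv h (p : 'rV[R]_n) : atlas h -> img h p ->
  exists2 C : R, 0 < C & \forall q \near p, forall u,
    `|u| <= C * tnorm (coord_vector h (cinv h q) u) /\
    tnorm (coord_vector h (cinv h q) u) <= C * `|u|.
Proof.
move=> ah hp.
pose S : set 'rV[R]_n := [set u | `|u| = 1].
have cS : compact S.
  apply: bounded_closed_compact.
    by exists 1; split=> // y y1 u /= ->; exact: ltW.
  rewrite (_ : S = (fun u : 'rV[R]_n => `|u|) @^-1` [set 1])//.
  apply: preimage_closed; last exact: closed_eq.
  by move=> ? _; apply: norm_continuous.
have nS : \forall cq \near (filter_prod (0 : R)^'+ (nbhs p)),
    S `<=` [set u | cq.1 < chart_metric h cq.2 u u /\
                    chart_metric h cq.2 u u < cq.1^-1].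
  apply: ((compact_near_coveringP _).1 cS) => // u Su.
  have u0 : u != 0 by rewrite -normr_gt0 Su.
  have Q0 := chart_metric_gt0 ah hp u0.
  set Q := chart_metric h p u u in Q0.
  have cQ : chart_metric h z.1 z.2 z.2 @[z --> (p, u)] --> Q.
    pose p1 (z : 'rV[R]_n * 'rV[R]_n) := z.1.
    pose p2 (z : 'rV[R]_n * 'rV[R]_n) := z.2.
    have c2 : {for (p, u), continuous p2} by exact: cvg_snd.
    have c1 : {for (p, u), continuous p1} by exact: cvg_fst.
    exact: (@chart_metric_continuous h _ p1 p2 p2 (p, u) ah hp c1 c2 c2).
  (* Any positive [c] below [c1] satisfies both [c < Q / 2] and [Q + 1 < c^-1]. *)
  pose c1 := Num.min (Q / 2) (Q + 1)^-1.
  have c10 : 0 < c1 by rewrite lt_min invr_gt0; lra.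
  have nQ : \forall z \near (p, u),
      Q / 2 < chart_metric h z.1 z.2 z.2 /\ chart_metric h z.1 z.2 z.2 < Q + 1.
    have Q2 : Q / 2 < Q by lra.
    have Q1 : Q < Q + 1 by lra.
    have n2 : \forall z \near (p, u), Q / 2 < chart_metric h z.1 z.2 z.2.
      exact: (cvgr_gt Q cQ _ Q2).
    have n1 : \forall z \near (p, u), chart_metric h z.1 z.2 z.2 < Q + 1.
      exact: (cvgr_lt Q cQ _ Q1).
    by near=> z; split; near: z.
  case: nQ => -[A1 A2] /= [pA uA] AQ.
  exists (A2, [set cq | cq.1 < c1 /\ 0 < cq.1 /\ A1 cq.2]) => /=.
    split=> //.
    exists ([set c | c < c1 /\ 0 < c], A1) => /=; last by move=> [? ?] /= [[]].
    split=> //; near=> c; split; near: c.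
      exact: nbhs_right_lt.
    exact: nbhs_right_gt.
  move=> [v [c q]] /= [A2v [cc1 [c0 A1q]]].
  have [h1 h2] := AQ (q, v) (conj A1q A2v).
  move: cc1; rewrite lt_min => /andP[cQ2 cQ1]; split.
    by rewrite (lt_trans cQ2).
  rewrite (lt_trans h2)// -(invrK (Q + 1)) ltf_pV2// posrE invr_gt0; lra.
have [[A1 A2] /= [A1c A2p] AS] := nS.
(* With [c < 1] one has [c ^+ 2 <= c], so after the square root the bounds [c] and [c^-1] on the
   squared norm still hold for the norm. *)
have [c [A1c' c0]] : exists c, A1 c /\ 0 < c < 1.
  have : \forall c \near (0 : R)^'+, A1 c /\ 0 < c < 1.
    near=> c; split; first by near: c.
    by apply/andP; split; near: c; [exact: nbhs_right_gt|exact: nbhs_right_lt].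
  by move=> /filter_ex[c ?]; exists c.
have [{}c0 c1] := andP c0.
exists c^-1; first by rewrite invr_gt0.
near=> q => u.
have A2q : A2 q by near: q.
have hq : img h q by near: q; exact: chart_nbhs_img.
have hx := cinv_dom hq.
have [->|u0] := eqVneq u 0.
  have -> : coord_vector h (cinv h q) 0 = 0 by rewrite coord_vectorE// linear0.
  by rewrite /tnorm metric0l sqrtr0 normr0 mulr0.
have nu : 0 < `|u| by rewrite normr_gt0.
pose w := `|u|^-1 *: u.
have Sw : `|w| = 1 by rewrite normrZ normfV normr_id mulVf// gt_eqF.
have uE : u = `|u| *: w by rewrite scalerA mulfV ?gt_eqF// scale1r.
have [h1 h2] := AS (c, q) (conj A1c' A2q) w Sw.
rewrite /= in h1 h2.
rewrite uE coord_vectorZ// tnormZ normrZ normr_id Sw mulr1.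
rewrite mulrCA [c^-1 * `|u|]mulrC.
have c2 : c ^+ 2 <= c by rewrite expr2 ger_pMl// ltW.
split; rewrite -[leLHS]mulr1 -?mulrA ler_pM2l ?mul1r//.
  rewrite ler_pdivlMl// mulr1 -[leLHS](ger0_norm (ltW c0)) -sqrtr_sqr.
  by rewrite ler_wsqrtr// (le_trans c2)// ltW.
have -> : c^-1 = Num.sqrt (c^-1 ^+ 2).
  by rewrite sqrtr_sqr ger0_norm// invr_ge0 ltW.
rewrite ?mulr1 ler_wsqrtr// (le_trans (ltW h2))// exprVn lef_pV2// posrE.
by rewrite exprn_gt0.
Unshelve. all: by end_near. Qed.

End riemannian.

(** * Derivatives along lines and under time reversal *)

Lemma near_cvg (T U : Type) (F : set_system T) (G : set_system U)
    (f : T -> U) (P : U -> Prop) :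
  f x @[x --> F] --> G -> (\forall y \near G, P y) ->
  \forall x \near F, P (f x).
Proof. by move=> /(_ P). Qed.

Lemma derivable_line (R : realType) (V W : normedModType R) (f : V -> W)
    (p v : V) (s : R) :
  derivable f (p + s *: v) v -> derivable (fun t : R => f (p + t *: v)) s 1.
Proof.
rewrite /derivable; set F := (X in cvg (X @ _)) => H.
set G := (X in cvg (X @ _)); suff -> : G = F by [].
apply/funext => t; rewrite /G /F /= [t%:A]mulr1 scalerDl.
by rewrite (addrCA p).
Qed.

Lemma derive1_line (R : realType) (V W : normedModType R) (f : V -> W)
    (p v : V) (s : R) :
  derive1 (fun t : R => f (p + t *: v)) s = 'D_v f (p + s *: v).
Proof.
rewrite /derive1 /derive; set F := (X in lim (X @ _)).
set G := (X in _ = lim (X @ _)); suff -> : G = F by [].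
apply/funext => t; rewrite /G /F /= scalerDl.
by rewrite (addrCA p).
Qed.

Lemma derivable_rev (R : realType) (V : normedModType R) (p : R -> V) (s : R) :
  derivable p (1 - s) 1 ->
  derivable (fun t : R => p (1 - t)) s 1 /\
  derive1 (fun t : R => p (1 - t)) s = - derive1 p (1 - s).
Proof.
move=> dp; have dp' : differentiable p (1 + s *: (-1 : R^o)).
  by rewrite [s *: _]mulrN1; exact/derivable1_diffP.
have E : (fun t : R => p (1 - t)) = (fun t : R => p (1 + t *: (-1 : R^o))).
  by apply/funext => t; rewrite [t *: _]mulrN1.
rewrite E; split; first exact/derivable_line/diff_derivable.
rewrite derive1_line deriveE// derive1E deriveE; last exact/derivable1_diffP.
rewrite [s *: _]mulrN1; exact: raddfN.
Qed.

(** * Length of curves *)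

Section curves.
Context (R : realType) (n : nat) (M : riemannianManifold R n).
Implicit Types (h : chart R n M) (x y z : M) (c : R -> M).

Lemma near_tnorm_velocity h c (t : R) : C1_curve c -> 0 <= t <= 1 ->
  atlas h -> dom h (c t) ->
  \forall s \near t, [/\ dom h (c s), derivable (cmap h \o c) s 1 &
    tnorm (velocity c s) =
    tnorm (coord_vector h (c s) (derive1 (cmap h \o c) s))].
Proof.
move=> Cc t01 ah ht; have [cc /(_ h ah ht)[dc _]] := Cc t t01.
have : \forall s \near t, dom h (c s) by apply: cc; exact: chart_nbhs_dom.
move=> /near_join hs.
near=> s; have hcs : \forall s' \near s, dom h (c s') by near: s.
have ds : derivable (cmap h \o c) s 1 by near: s.
have E := velocityE ah hcs ds.
by split; [exact: nbhs_singleton hcs|exact: ds|rewrite E].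
Unshelve. all: by end_near. Qed.

Lemma speed_continuous c (t : R) : C1_curve c -> 0 <= t <= 1 ->
  {for t, continuous (fun s : R => tnorm (velocity c s))}.
Proof.
move=> Cc t01; pose h := chart_at (c t).
have ah : atlas h by exact: chart_at_atlas.
have ht : dom h (c t) by exact: chart_at_dom.
have [cc /(_ h ah ht)[_ cD]] := Cc t t01.
have nv := near_tnorm_velocity Cc t01 ah ht.
pose p := cmap h \o c; pose D := derive1 p.
pose Q s := chart_metric h (p s) (D s) (D s).
have cp : {for t, continuous p}.
  exact: (cvg_comp _ _ cc (cmap_continuous ht)).
have cQ : {for t, continuous Q}.
  by apply: chart_metric_continuous => //; exact: cmap_img.
have E s : dom h (c s) /\ tnorm (velocity c s) =
    tnorm (coord_vector h (c s) (D s)) -> tnorm (velocity c s) = Num.sqrt (Q s).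
  by move=> [hs ->]; rewrite /tnorm /Q /chart_metric /p /= cmapK.
have [_ _ vt] := nbhs_singleton nv.
have {}vt := E t (conj ht vt); rewrite /prop_for /continuous_at vt.
have cS : Num.sqrt (Q s) @[s --> t] --> Num.sqrt (Q t).
  exact: (cvg_comp _ _ cQ (@sqrt_continuous _ (Q t))).
apply: cvg_trans cS; apply: near_eq_cvg; near=> s.
have [hs _ vs] : [/\ dom h (c s), derivable (cmap h \o c) s 1 &
    tnorm (velocity c s) = tnorm (coord_vector h (c s) (D s))] by near: s.
exact/esym/(E s (conj hs vs)).
Unshelve. all: by end_near. Qed.

Lemma speed_within_continuous c : C1_curve c ->
  {within `[0, 1], continuous (fun s : R => tnorm (velocity c s))}.
Proof.
move=> Cc; apply: continuous_in_subspaceT => t; rewrite inE/= in_itv/= => t01.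
exact: speed_continuous.
Qed.

Lemma speed_integrable c : C1_curve c ->
  lebesgue_measure.-integrable `[0%R, 1%R]
    (EFin \o (fun s : R => tnorm (velocity c s))).
Proof.
move=> Cc; apply: continuous_compact_integrable; first exact: segment_compact.
exact: speed_within_continuous.
Qed.

Lemma curve_length_ge0 c : 0 <= curve_length c.
Proof. by apply: Rintegral_ge0 => t _; exact: tnorm_ge0. Qed.

Lemma curve_length_le c (L : R) : C1_curve c ->
  (forall t : R, 0 <= t <= 1 -> tnorm (velocity c t) <= L) ->
  curve_length c <= L.
Proof.
move=> Cc cL.
have -> : L = (\int[lebesgue_measure]_(t in `[0%R, 1%R]) L)%R.
  by rewrite Rintegral_cst//= lebesgue_measure_itv/= lte01 oppr0 adde0 mulr1.
apply: (le_Rintegral _ (speed_integrable Cc)) => //.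
  apply: continuous_compact_integrable; first exact: segment_compact.
  by apply: continuous_subspaceT => ?; exact: cvg_cst.
Qed.

Lemma C1_curve_rev c : C1_curve c -> C1_curve (fun t : R => c (1 - t)).
Proof.
move=> Cc t t01; have t01' : 0 <= 1 - t <= 1 by lra.
have [cc ch] := Cc _ t01'.
have cr : (1 - s) @[s --> t] --> 1 - t by apply: cvgB; [exact: cvg_cst|exact: cvg_id].
split; first exact: (cvg_comp _ _ cr cc).
move=> h ah ht; have [dh cD] := ch h ah ht.
have nd : \forall s \near t, derivable (cmap h \o c) (1 - s) 1.
    exact: (near_cvg cr dh).
split.
  near=> s; have ds : derivable (cmap h \o c) (1 - s) 1 by near: s.
  exact: (derivable_rev ds).1.
have cN : - derive1 (cmap h \o c) (1 - s) @[s --> t] -->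
          - derive1 (cmap h \o c) (1 - t).
  by apply: cvgN; exact: (cvg_comp _ _ cr cD).
have E s : derivable (cmap h \o c) (1 - s) 1 ->
    derive1 (cmap h \o (fun t : R => c (1 - t))) s = - derive1 (cmap h \o c) (1 - s).
  by move=> ds; exact: (derivable_rev ds).2.
have Et := E t (nbhs_singleton nd); rewrite /prop_for /continuous_at Et.
apply: cvg_trans cN; apply: near_eq_cvg; near=> s.
have ds : derivable (cmap h \o c) (1 - s) 1 by near: s.
exact/esym/(E s ds).
Unshelve. all: by end_near. Qed.

Lemma curve_length_rev c : C1_curve c ->
  curve_length (fun t : R => c (1 - t)) = curve_length c.
Proof.
move=> Cc; rewrite /curve_length.
have o01 : 0 <= (1 : R) <= 1 by rewrite ler01 lexx.
apply/esym; apply: etrans.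
  exact: (Rintegration_by_substitution_onem o01 (speed_within_continuous Cc)).
rewrite unstable.onem1; apply/esym; apply: eq_Rintegral => t; rewrite inE/= in_itv/= => t01.
have t01' : 0 <= 1 - t <= 1 by lra.
pose k := chart_at (c (1 - t)).
have [_ /(_ k (chart_at_atlas _) (chart_at_dom _))[dk _]] := Cc _ t01'.
have [_ E] := derivable_rev (nbhs_singleton dk).
have V : velocity (fun t : R => c (1 - t)) t =
    -1 *: (velocity c (1 - t) : 'rV[R]_n) :> 'rV[R]_n.
  by rewrite scaleN1r; exact: E.
apply: (etrans (congr1 (@tnorm R n M (c (1 - t))) V)).
apply: (etrans (tnormZ _ _ _)).
by rewrite normrN1 mul1r.
Qed.

Lemma line_continuous (p v : 'rV[R]_n) (t : R) :
  p + s *: v @[s --> t] --> p + t *: v.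
Proof.
apply: cvgD; first exact: cvg_cst.
by apply: cvgZr_tmp; exact: cvg_id.
Qed.

(** Coordinate segments, together with their reversals, are the only curves ever constructed; all
    paths are concatenations of these. *)
Lemma segment_C1 h (p v : 'rV[R]_n) : atlas h ->
  (forall t : R, 0 <= t <= 1 -> img h (p + t *: v)) ->
  C1_curve (fun t : R => cinv h (p + t *: v)).
Proof.
move=> ah hp t t01; have ht := hp t t01; have cl := @line_continuous p v t.
split; first exact: (cvg_comp _ _ cl (cinv_continuous ht)).
move=> k ak kt.
have ns : \forall s \near t, img h (p + s *: v) /\ dom k (cinv h (p + s *: v)).
  near=> s; split; near: s.
    exact: (cl _ (chart_nbhs_img ht)).
  exact: (cl _ (chart_near_cinv ht (chart_nbhs_dom kt))).
split.
  near=> s; have [hs ks] : img h (p + s *: v) /\ dom k (cinv h (p + s *: v)).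
    by near: s.
  apply: (derivable_line (f := cmap k \o cinv h)); apply: diff_derivable.
  exact: transition_differentiable.
have -> : derive1 (cmap k \o (fun t : R => cinv h (p + t *: v))) =
    (fun s : R => 'D_v (cmap k \o cinv h) (p + s *: v)).
  by apply/funext => s; exact: (derive1_line (cmap k \o cinv h)).
have cD : 'D_v (cmap k \o cinv h) q @[q --> p + t *: v] -->
    'D_v (cmap k \o cinv h) (p + t *: v).
  exact: (transition_derive_continuous ah ak ht kt).
exact: (cvg_comp _ _ cl cD).
Unshelve. all: by end_near. Qed.

Lemma segment_length h (p v : 'rV[R]_n) (L : R) : atlas h ->
  (forall t : R, 0 <= t <= 1 -> img h (p + t *: v)) ->
  (forall t : R, 0 <= t <= 1 ->
    tnorm (coord_vector h (cinv h (p + t *: v)) v) <= L) ->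
  curve_length (fun t : R => cinv h (p + t *: v)) <= L.
Proof.
move=> ah hp vL; have Cc := segment_C1 ah hp.
apply: (curve_length_le Cc) => t t01; have ht := hp t t01.
have cl := @line_continuous p v t.
have ns : \forall s \near t, img h (p + s *: v) by exact: (cl _ (chart_nbhs_img ht)).
have nd : \forall s \near t, dom h (cinv h (p + s *: v)).
  by near=> s; apply: cinv_dom; near: s.
have [_ /(_ h ah (cinv_dom ht))[dh _]] := Cc t t01.
rewrite (velocityE ah nd (nbhs_singleton dh)).
suff -> : derive1 (cmap h \o (fun t : R => cinv h (p + t *: v))) t = v by exact: vL.
rewrite derive1E (@near_eq_derive _ _ _ _ (fun s : R => id (p + s *: v))).
  by rewrite -derive1E (derive1_line id p v t) derive_id.
by near=> s; rewrite /= cinvK//; near: s.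
Unshelve. all: by end_near. Qed.

End curves.

(** * The Riemannian distance *)

Section distance.
Context (R : realType) (n : nat) (M : riemannianManifold R n).
Implicit Types (h : chart R n M) (x y z : M) (c : R -> M) (cs : seq (R -> M)).

Definition path_length cs : R := \sum_(c <- cs) curve_length c.

Lemma path_length_ge0 cs : 0 <= path_length cs.
Proof. by apply: sumr_ge0 => c _; exact: curve_length_ge0. Qed.

Lemma path_cat x y z cs ds :
  piecewise_C1_path x y cs -> piecewise_C1_path y z ds ->
  piecewise_C1_path x z (cs ++ ds).
Proof.
elim: cs x => [x /= -> //|c cs IH x /= [Cc c0 Pc] Pd].
by split=> //; exact: IH.
Qed.

Lemma path_rev x y cs : piecewise_C1_path x y cs ->
  exists2 ds, piecewise_C1_path y x ds & path_length ds = path_length cs.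
Proof.
elim: cs x => [x /= ->|c cs IH x /= [Cc c0 /IH[ds Pd Ld]]]; first by exists [::].
exists (ds ++ [:: fun t : R => c (1 - t)]).
  apply: path_cat Pd _ => /=.
  by rewrite subr0 subrr; split=> //; exact: C1_curve_rev.
rewrite /path_length big_cat big_seq1 big_cons /= (curve_length_rev Cc) addrC.
by congr (_ + _).
Qed.

Lemma rdist_le_length x y cs : piecewise_C1_path x y cs ->
  rdist x y <= path_length cs.
Proof.
move=> Pc; apply: ge_inf; last by exists cs.
by exists 0 => _ [ds _ <-]; exact: path_length_ge0.
Qed.

Lemma rdist_ge0 x y : 0 <= rdist x y.
Proof.
rewrite /rdist; set S := [set _ | _ in _].
(* Existence of paths is not yet known; the infimum of the empty set is 0 by convention. *)
have [->|/set0P S0] := eqVneq S set0; first by rewrite inf0.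
by apply: lb_le_inf => // _ [ds _ <-]; exact: path_length_ge0.
Qed.

Lemma rdistxx x : rdist x x = 0.
Proof.
apply/eqP; rewrite eq_le rdist_ge0 andbT.
by rewrite (le_trans (@rdist_le_length x x [::] _))// /path_length big_nil.
Qed.

Lemma rdist_sym x y : rdist x y = rdist y x.
Proof.
rewrite /rdist; congr (inf _); apply/seteqP.
by split=> _ [cs /path_rev[ds Pd Ld] <-]; exists ds.
Qed.

Lemma rdist_segment h (p v : 'rV[R]_n) (L : R) : atlas h ->
  (forall t : R, 0 <= t <= 1 -> img h (p + t *: v)) ->
  (forall t : R, 0 <= t <= 1 ->
    tnorm (coord_vector h (cinv h (p + t *: v)) v) <= L) ->
  exists2 cs, piecewise_C1_path (cinv h p) (cinv h (p + v)) cs &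
    path_length cs <= L.
Proof.
move=> ah hp vL; exists [:: fun t : R => cinv h (p + t *: v)] => /=.
  by rewrite scale0r addr0 scale1r; split=> //; exact: segment_C1.
by rewrite /path_length big_seq1; exact: segment_length.
Qed.

(** The path itself is kept, and not just the bound on [rdist], because [path_exists] is deduced
    from it. *)
Lemma near_short_path x (e : R) : 0 < e -> \forall y \near x,
  exists2 cs, piecewise_C1_path x y cs & path_length cs <= e.
Proof.
move=> e0; pose h := chart_at x; have ah : atlas h := chart_at_atlas x.
have hx : dom h x := chart_at_dom x.
have hp := cmap_img hx; set p := cmap h x in hp.
have [C C0 nC] := chart_norm_equiv ah hp.
have [r /= r0 rC] : exists2 r : R, 0 < r & forall q, `|p - q| < r ->
    img h q /\ forall u, tnorm (coord_vector h (cinv h q) u) <= C * `|u|.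
  have : \forall q \near p, img h q /\
      forall u, tnorm (coord_vector h (cinv h q) u) <= C * `|u|.
    near=> q; split; first by near: q; exact: chart_nbhs_img.
    have H : forall u, `|u| <= C * tnorm (coord_vector h (cinv h q) u) /\
       tnorm (coord_vector h (cinv h q) u) <= C * `|u| by near: q.
    by move=> u; exact: (H u).2.
  by move=> /nbhs_normP[r r0 H]; exists r.
(* Radius [r] keeps the segment where the norm estimate holds; [e / C] makes its length at most
   [e]. *)
have eC : 0 < Num.min r (e / C) by rewrite lt_min r0 divr_gt0.
have nq : \forall q \near p, `|p - q| < Num.min r (e / C).
  by apply/nbhs_normP; exists (Num.min r (e / C)).
have ny := chart_near_cmap hx nq; near=> y.
have hy : dom h y by near: y; exact: chart_nbhs_dom.
have : `|p - cmap h y| < Num.min r (e / C).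
  by near: y; exact: ny.
rewrite lt_min distrC => /andP[yr ye].
have tr t : 0 <= t <= 1 -> `|p - (p + t *: (cmap h y - p))| < r.
  move=> /andP[t0 t1]; rewrite opprD addNKr normrN normrZ ger0_norm//.
  by apply: le_lt_trans yr; rewrite ler_piMl.
have := @rdist_segment h p (cmap h y - p) e ah.
rewrite [p + (_ - _)]addrC subrK (cmapK hx) (cmapK hy); apply.
  by move=> t /tr/rC[].
move=> t /tr/rC[_ /(_ (cmap h y - p))] H; apply: le_trans H _.
by rewrite mulrC -ler_pdivlMr// ltW.
Unshelve. all: by end_near. Qed.

(** The set reachable from [x] is open by short paths and closed by reversing them; connectedness
    concludes. *)
Lemma path_exists x y : exists cs, piecewise_C1_path x y cs.
Proof.
pose A := [set y : M | exists cs, piecewise_C1_path x y cs].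
suff AT : A = setT by have : [set: M] y by []; rewrite -AT.
have near_path u : \forall v \near u, exists cs, piecewise_C1_path u v cs.
  by apply: filterS (near_short_path u ltr01) => v [cs Pc _]; exists cs.
apply: (riemannian_connected (r := M)).
- by exists x, [::].
- exists A; last by rewrite setTI.
  rewrite openE => u [cs Pc]; apply: filterS (near_path u) => v [ds Pd].
  by exists (cs ++ ds); exact: path_cat Pd.
- exists A; last by rewrite setTI.
  rewrite -[A]setCK; apply: open_closedC; rewrite openE => u nAu.
  apply: filterS (near_path u) => v [ds /path_rev[ds' Pd _]] [cs Pc].
  by apply: nAu; exists (cs ++ ds'); exact: path_cat Pd.
Qed.

Lemma rdist_tri x y z : rdist x z <= rdist x y + rdist y z.
Proof.
have hi (u v : M) : has_inf
    [set \sum_(c <- cs) curve_length c | cs in piecewise_C1_path u v].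
  have [cs Pc] := path_exists u v.
  split; first by exists (path_length cs), cs.
  by exists 0 => _ [ds _ <-]; exact: path_length_ge0.
apply/ler_addgt0Pr => e e0; have e2 : 0 < e / 2 by lra.
have [_ [cs Pc <-] Lc] := inf_adherent e2 (hi x y).
have [_ [ds Pd <-] Ld] := inf_adherent e2 (hi y z).
apply: (le_trans (rdist_le_length (path_cat Pc Pd))).
rewrite /path_length big_cat /=; rewrite /rdist; lra.
Qed.

Lemma near_rdist x (e : R) : 0 < e -> \forall y \near x, rdist x y <= e.
Proof.
move=> /(near_short_path x); apply: filterS => y [cs Pc]; apply: le_trans.
exact: rdist_le_length.
Qed.

Lemma curve_growth (g : M -> R) (C : R) c : 0 <= C -> C1_curve c ->
  continuous g ->
  (forall t e : R, 0 <= t < 1 -> 0 < e -> \forall s \near t^'+,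
     g (c s) - g (c t) <= (C * tnorm (velocity c t) + e) * (s - t)) ->
  g (c 1) - g (c 0) <= C * curve_length c.
Proof.
move=> C0 Cc cg gc.
(* [dini_le_integral] wants an integrand continuous on the whole line, whereas [c] is only
   controlled on [0, 1]. *)
pose clamp (t : R) := Num.max 0 (Num.min t 1).
have clampE t : 0 <= t <= 1 -> clamp t = t.
  by move=> /andP[t0 t1]; rewrite /clamp (min_idPl t1) (max_idPr t0).
have clamp01 t : 0 <= clamp t <= 1.
  by rewrite /clamp le_max lexx/= ge_max ler01 ge_min lexx orbT.
pose K t := C * tnorm (velocity c (clamp t)).
have cK : continuous K.
  move=> t; have cc : clamp s @[s --> t] --> clamp t.
    have cm : {for t, continuous (fun s : R => Num.min s 1)}.
      apply: (@continuous_min R R (fun s => s) (fun=> 1) t); first exact: cvg_id.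
      exact: cvg_cst.
    exact: (@continuous_max R R (fun=> 0) _ t (@cvg_cst _ _ _ _ _) cm).
  have cv := cvg_comp _ _ cc (speed_continuous Cc (clamp01 t)).
  exact: (cvgM (cvg_cst C) cv).
have -> : C * curve_length c = (\int[lebesgue_measure]_(t in `[0, 1]) K t)%R.
  have E := fun mI => RintegralZl C mI (speed_integrable Cc).
  apply: (etrans (esym (E (measurable_itv _)))).
  apply: eq_Rintegral => t; rewrite inE/= in_itv/= => t01.
  by rewrite /K clampE.
apply: (@dini_le_integral R (g \o c) K cK).
  apply: continuous_in_subspaceT => t; rewrite inE/= in_itv/= => t01.
  exact: (cvg_comp _ _ (Cc t t01).1 (cg (c t))).
move=> t e t01 e0; rewrite /K clampE; last by lra.
exact: gc.
Qed.

(** Leaving the coordinate ball of radius [r] around [x] costs length at least [r / C], whatever the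
    path, by the comparison of norms inside that ball. *)
Lemma rdist_nbhs x (U : set M) : nbhs x U ->
  exists2 r : R, 0 < r & forall y, rdist x y < r -> U y.
Proof.
move=> xU; pose h := chart_at x; have ah : atlas h := chart_at_atlas x.
have hx : dom h x := chart_at_dom x.
have hp := cmap_img hx; set p := cmap h x in hp.
have [C C0 nC] := chart_norm_equiv ah hp.
have [r /= r0 rC] : exists2 r : R, 0 < r & forall q, `|q - p| <= r ->
    [/\ img h q, U (cinv h q) &
      forall u, `|u| <= C * tnorm (coord_vector h (cinv h q) u)].
  have nU : \forall q \near p, U (cinv h q).
    by apply: chart_near_cinv; rewrite // cmapK.
  have : \forall q \near p, [/\ img h q, U (cinv h q) &
      forall u, `|u| <= C * tnorm (coord_vector h (cinv h q) u)].
    near=> q; split; [by near: q; exact: chart_nbhs_img|by near: q|].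
    have H : forall u, `|u| <= C * tnorm (coord_vector h (cinv h q) u) /\
       tnorm (coord_vector h (cinv h q) u) <= C * `|u| by near: q.
    by move=> u; exact: (H u).1.
  move=> /nbhs_normP[r /= r0 H]; exists (r / 2); first by lra.
  by move=> q qr; apply: H; rewrite /= distrC (le_lt_trans qr)//; lra.
pose K := [set y | dom h y /\ `|cmap h y - p| <= r].
have Kcl : closed K.
  by apply: chart_ball_closed => [|q /rC[]//]; exact: manifold_hausdorff.
(* [g] is the chart distance to x cut off at r; along curves it grows at most
   [C] times as fast as the length. *)
pose g y := if `[< dom h y >] then Num.min `|cmap h y - p| r else r.
have gd y : dom h y -> g y = Num.min `|cmap h y - p| r.
  by move=> hy; rewrite /g asboolT.
have gK y : ~ K y -> g y = r.
  rewrite /g; case: asboolP => // hy nK; apply/min_idPr.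
  by rewrite leNgt; apply/negP => /ltW le_r; apply: nK.
have nK y : ~ K y -> \forall z \near y, ~ K z.
  by move=> Ky; apply: open_nbhs_nbhs; split=> //; exact: closed_openC.
have cg : continuous g.
  move=> y; have [hy|hy] := pselect (dom h y).
    have cm : Num.min `|cmap h z - p| r @[z --> y] --> Num.min `|cmap h y - p| r.
      have cn : {for y, continuous (fun z => `|cmap h z - p| : R^o)}.
        apply: cvg_norm; apply: cvgB; last exact: cvg_cst.
        exact: cmap_continuous.
      exact: (@continuous_min R M _ (fun=> r) y cn (@cvg_cst _ _ _ _ _)).
    rewrite /continuous_at gd//; apply: cvg_trans cm; apply: near_eq_cvg.
    by apply: filterS (chart_nbhs_dom hy) => z hz; rewrite gd.
  have Ky : ~ K y by case.
  rewrite /continuous_at gK//; apply: cvg_near_cst.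
  by apply: filterS (nK y Ky) => z; exact: gK.
have g_curve c : C1_curve c -> g (c 1) - g (c 0) <= C * curve_length c.
  move=> Cc; apply: curve_growth => //; first exact: ltW.
  move=> t e /andP[t0 t1] e0; have t01 : 0 <= t <= 1 by rewrite t0 ltW.
  have cc := (Cc t t01).1.
  (* Off the closed set [K] the function [g] is locally constant. On [K], even at its boundary,
     [g (c t)] is the untruncated distance while truncation can only lower [g (c s)], so the
     derivative of the coordinates bounds the growth. *)
  have [Kt|Kt] := pselect (K (c t)); last first.
    have nKc : \forall s \near t^'+, ~ K (c s).
      exact: (cvg_within _ (near_cvg cc (nK _ Kt))).
    near=> s; have st : t <= s by near: s; exact: nbhs_right_ge.
    have Ks : ~ K (c s) by near: s.
    rewrite (gK _ Ks) (gK _ Kt) subrr; apply: mulr_ge0; last by rewrite subr_ge0.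
    apply: addr_ge0; last exact: ltW.
    by apply: mulr_ge0; [exact: ltW|exact: tnorm_ge0].
  have [ht htr] := Kt.
  have [_ /(_ h ah ht)[dh _]] := Cc t t01.
  have nh : \forall s \near t, dom h (c s).
    exact: (near_cvg cc (chart_nbhs_dom ht)).
  have dt := nbhs_singleton dh.
  have V := velocityE ah nh dt.
  have [_ _ /(_ (derive1 (cmap h \o c) t))] := rC _ htr.
  rewrite (cmapK ht) -V => DV.
  have nD := derivable_near_right dt e0.
  have nh' : \forall s \near t^'+, dom h (c s) by exact: (cvg_within _ nh).
  near=> s.
  have st : 0 < s - t by rewrite subr_gt0; near: s; exact: nbhs_right_gt.
  have hs : dom h (c s) by near: s.
  have Ds : `|(cmap h \o c) s - (cmap h \o c) t -
     (s - t) *: derive1 (cmap h \o c) t| <= e * (s - t) by near: s.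
  rewrite gd// (gd (c t))// (min_idPl htr).
  rewrite (@le_trans _ _ (`|cmap h (c s) - p| - `|cmap h (c t) - p|))//.
    by rewrite lerB// ge_min lexx.
  apply: (le_trans (lerB_dist _ _)); rewrite opprB addrA subrK.
  rewrite -[_ - _](subrK ((s - t) *: derive1 (cmap h \o c) t)).
  apply: (le_trans (ler_normD _ _)); rewrite mulrDl addrC; apply: lerD => //.
  by rewrite normrZ gtr0_norm// mulrC ler_pM2r.
have g_path z y cs : piecewise_C1_path z y cs -> g y <= g z + C * path_length cs.
  elim: cs z => [z /= ->|c cs IH z /= [Cc <- /IH gy]].
    by rewrite /path_length big_nil mulr0 addr0.
  rewrite /path_length big_cons mulrDr; have := g_curve c Cc.
  rewrite -/(path_length cs); lra.
exists (r / C); first exact: divr_gt0.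
move=> y xy.
have hi : has_inf [set \sum_(c <- cs) curve_length c | cs in piecewise_C1_path x y].
  have [cs Pc] := path_exists x y.
  split; first by exists (path_length cs), cs.
  by exists 0 => _ [ds _ <-]; exact: path_length_ge0.
have e0 : 0 < r / C - rdist x y by lra.
have [_ [cs Pc <-]] := inf_adherent e0 hi.
rewrite -/(rdist x y) addrC subrK -/(path_length cs) ltr_pdivlMr// mulrC => Lr.
have gy : g y < r.
  apply: (le_lt_trans (g_path _ _ _ Pc)).
  by rewrite gd// subrr normr0 (min_idPl (ltW r0)) add0r.
have [[hy yr]|/gK gyr] := pselect (K y); last by rewrite gyr ltxx in gy.
by have [_ + _] := rC _ yr; rewrite cmapK.
Unshelve. all: by end_near. Qed.

End distance.

(** * Horizontal lifts *)

Section lift.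
Context (R : realType) (m n : nat) (M : riemannianManifold R m).
Context (B : riemannianManifold R n) (pi : M -> B).
Hypothesis pi_smooth : smooth_map pi.

Definition gram (x : M) : 'M[R]_m :=
  \matrix_(i, j) metric x (delta_mx 0 i) (delta_mx 0 j).

Lemma metric_gram (x : M) u v : metric x u v = (u *m gram x *m v^T) 0 0.
Proof.
rewrite {1}[u]row_sum_delta metric_suml {1}[v]row_sum_delta.
under eq_bigr => i _ do rewrite metric_sumr mulr_sumr.
rewrite exchange_big /= mxE; apply: eq_bigr => j _.
rewrite !mxE mulr_suml; apply: eq_bigr => i _.
by rewrite mxE mulrAC mulrA.
Qed.

Lemma unitmx_inj p (A : 'M[R]_p) :
  (forall u : 'rV[R]_p, u *m A = 0 -> u = 0) -> A \in unitmx.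
Proof.
move=> A0; rewrite unitmxE unitfE; apply/negP => /det0P[u u0 /A0 uE].
by rewrite uE eqxx in u0.
Qed.

Lemma metric_eq0 (x : M) u : metric x u u = 0 -> u = 0.
Proof.
move=> u0; apply/eqP; apply/negPn/negP => /(metric_pos x).
by rewrite u0 ltxx.
Qed.

Lemma map_differentiable h k (x : M) : atlas h -> atlas k ->
  dom h x -> dom k (pi x) -> differentiable (cmap k \o pi \o cinv h) (cmap h x).
Proof.
move=> ah ak hx kx; have [H _] := pi_smooth.2 h k ah ak 1%N; apply: H.
by split; [exact: cmap_img|rewrite /= cmapK].
Qed.

(* The lift of [w] is [w N^-1 A^T G^-1], where [A] is the Jacobian of [pi], [G] the
   Gram matrix of the metric at [x] and [N = A^T G^-1 A] (row vectors). *)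
Lemma horizontal_lift_exists (x : M) (w : tangent (pi x)) : maximal_rank pi ->
  exists v : tangent x, horizontal_lift w v.
Proof.
move=> pi_rank.
pose F := cmap (chart_at (pi x)) \o pi \o cinv (chart_at x).
pose A := jacobian F (cmap (chart_at x) x).
have TA (v : 'rV[R]_m) : tangent_map pi (v : tangent x) = v *m A.
  apply: deriveEjacobian; apply: map_differentiable;
    [exact: chart_at_atlas..|exact: chart_at_dom|exact: chart_at_dom].
pose G := gram x.
have GT : G^T = G by apply/matrixP => i j; rewrite !mxE Defs.metric_sym.
have Gu : G \in unitmx.
  apply: unitmx_inj => u uG; apply: (@metric_eq0 x).
  by rewrite metric_gram uG mul0mx mxE.
pose N := A^T *m invmx G *m A.
have Nu : N \in unitmx.
  apply: unitmx_inj => l lN.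
  (* The squared length of [s] is [l (l N)^T], hence 0. Then [l A^T] vanishes, and surjectivity of
     the derivative forces [l] to vanish. *)
  pose s := l *m A^T *m invmx G.
  have sG : s *m G = l *m A^T by rewrite /s mulmxKV.
  have s0 : s = 0.
    apply: (@metric_eq0 x); rewrite metric_gram sG -mulmxA -trmx_mul.
    by rewrite /s -!mulmxA [A^T *m _]mulmxA lN trmx0 mulmx0 mxE.
  have lA : l *m A^T = 0 by rewrite -sG s0 mul0mx.
  apply/rowP => i; rewrite [RHS]mxE.
  have [v Tv] := pi_rank x (delta_mx 0 i).
  have : (v *m A *m l^T) 0 0 = 0.
    by rewrite -mulmxA -[A]trmxK -trmx_mul lA trmx0 mulmx0 mxE.
  by rewrite -TA Tv -rowE !mxE.
exists (w *m invmx N *m A^T *m invmx G); split.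
  move=> u; rewrite /vertical /= TA => uA.
  rewrite Defs.metric_sym metric_gram mulmxKV// -mulmxA -trmx_mul uA.
  by rewrite trmx0 mulmx0 mxE.
by rewrite TA -!mulmxA [A^T *m _]mulmxA -/N mulVmx// mulmx1.
Qed.

(** Lifts are defined through the chart at [pi x], which varies with [x]; the descent needs the
    derivative in one fixed chart [k] of [B]. *)
Lemma derive_lift (k : chart R n B) (x : M) (e : 'rV[R]_n) (v : tangent x) :
  atlas k -> dom k (pi x) ->
  horizontal_lift (coord_vector k (pi x) e) v ->
  'D_v (cmap k \o pi \o cinv (chart_at x)) (cmap (chart_at x) x) = e.
Proof.
move=> ak kx [_ Tv].
set h := chart_at x; set k' := chart_at (pi x).
have ah : atlas h := chart_at_atlas x.
have hx : dom h x := chart_at_dom x.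
have ak' : atlas k' := chart_at_atlas _.
have kx' : dom k' (pi x) := chart_at_dom _.
have dF := map_differentiable ah ak hx kx.
have dF' := map_differentiable ah ak' hx kx'.
set F' := cmap k' \o pi \o cinv h in dF'.
have F'x : F' (cmap h x) = cmap k' (pi x) by rewrite /F' /= cmapK.
have dT : differentiable (cmap k \o cinv k') (F' (cmap h x)).
  rewrite F'x; apply: (transition_differentiable ak' ak (cmap_img kx')).
  by rewrite (cmapK kx').
have dTF' := differentiable_comp dF' dT.
have E : 'd F' (cmap h x) v = 'd (cmap k' \o cinv k) (cmap k (pi x)) e.
  exact: (etrans (esym (deriveE v dF')) (etrans Tv (coord_vectorE e ak kx))).
have npi : \forall y \near cinv h (cmap h x), dom k' (pi y).
  by rewrite (cmapK hx); exact: (near_cvg (pi_smooth.1 x) (chart_nbhs_dom kx')).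
have nE : \forall q \near cmap h x,
    (cmap k \o pi \o cinv h) q = ((cmap k \o cinv k') \o F') q.
  apply: filterS (chart_near_cinv (cmap_img hx) npi) => q hq.
  by rewrite /F' /= (cmapK hq).
apply: (etrans (near_eq_derive v nE)).
apply: (etrans (deriveE v dTF')).
apply: (etrans (congr1 (fun f => f v) (diff_comp dF' dT))).
apply: (etrans (congr1 ('d (cmap k \o cinv k') (F' (cmap h x))) E)).
rewrite F'x; exact: transitionK.
Qed.

(** The segment is tangent to [v] only at its start. Continuity of the metric bounds its length and
    differentiability of [pi] bounds the drift of its image, each up to [eps] per unit of
    parameter. *)
Lemma horizontal_step (k : chart R n B) (x : M) (e : 'rV[R]_n) (v : tangent x)
    (eps : R) : 0 < eps -> atlas k -> dom k (pi x) ->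
  horizontal_lift (coord_vector k (pi x) e) v ->
  \forall s \near (0 : R)^'+, exists y, [/\ rdist x y <= s * (tnorm v + eps),
    dom k (pi y) & `|cmap k (pi y) - cmap k (pi x) - s *: e| <= eps * s].
Proof.
move=> eps0 ak kx Hv; pose h := chart_at x.
have ah : atlas h := chart_at_atlas x.
have hx : dom h x := chart_at_dom x.
pose p := cmap h x; have hp : img h p := cmap_img hx.
pose F := cmap k \o pi \o cinv h.
have dF : differentiable F p := map_differentiable ah ak hx kx.
have dp : differentiable F (p + 0 *: (v : 'rV[R]_m)) by rewrite scale0r addr0.
have dv : derivable F (p + 0 *: (v : 'rV[R]_m)) v := diff_derivable dp.
have nF := derivable_near_right (derivable_line dv) eps0.
have DF : derive1 (fun t : R => F (p + t *: (v : 'rV[R]_m))) 0 = e.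
  rewrite derive1_line scale0r addr0; exact: derive_lift.
rewrite DF scale0r addr0 in nF.
pose S q := chart_metric h q v v.
have cS : Num.sqrt (S q) @[q --> p] --> Num.sqrt (S p).
  apply: (@cvg_comp _ _ _ S Num.sqrt (nbhs p) (nbhs (S p))).
    have ci : {for p, continuous (fun q : 'rV[R]_m => q)} by exact: cvg_id.
    have cv : {for p, continuous (fun _ : 'rV[R]_m => v : 'rV[R]_m)}.
      exact: (@cst_continuous _ _ (v : 'rV[R]_m)).
    exact: (@chart_metric_continuous _ _ _ h _ _ _ _ p ah hp ci cv cv).
  exact: sqrt_continuous.
have Sv : Num.sqrt (S p) = tnorm v.
  by rewrite /S /chart_metric /p (cmapK hx) coord_vector_chart_at.
have Sv' : Num.sqrt (S p) < tnorm v + eps by rewrite Sv ltrDl.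
have nS : \forall q \near p, Num.sqrt (S q) < tnorm v + eps.
  exact: (cvgr_lt _ cS _ Sv').
have npi : \forall y \near cinv h p, dom k (pi y).
  by rewrite (cmapK hx); exact: (near_cvg (pi_smooth.1 x) (chart_nbhs_dom kx)).
have nk := chart_near_cinv hp npi.
have nh := chart_nbhs_img hp.
have [r /= r0 rP] : exists2 r : R, 0 < r & forall q, `|p - q| < r ->
    [/\ img h q, dom k (pi (cinv h q)) & Num.sqrt (S q) < tnorm v + eps].
  have : \forall q \near p,
     [/\ img h q, dom k (pi (cinv h q)) & Num.sqrt (S q) < tnorm v + eps].
    by near=> q; split; near: q.
  by move=> /nbhs_normP[r r0 H]; exists r.
(* The added 1 allows [v = 0] in the division. *)
have nv0 : 0 < `|v : 'rV[R]_m| + 1 by rewrite ltr_wpDl.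
have rv : 0 < r / (`|v : 'rV[R]_m| + 1) by exact: divr_gt0.
near=> s.
have s0 : 0 < s by near: s; exact: nbhs_right_gt.
have sr : s * (`|v : 'rV[R]_m| + 1) < r.
  by rewrite -ltr_pdivlMr//; near: s; exact: nbhs_right_lt.
have tr t : 0 <= t <= 1 -> `|p - (p + t *: (s *: (v : 'rV[R]_m)))| < r.
  move=> /andP[t0 t1]; rewrite opprD addNKr normrN scalerA normrZ.
  rewrite normrM (ger0_norm t0) (gtr0_norm s0); apply: le_lt_trans sr.
  apply: ler_pM => //; first by rewrite mulr_ge0// ltW.
    by rewrite ler_piMl// ltW.
  by rewrite lerDl.
exists (cinv h (p + s *: (v : 'rV[R]_m))).
have o01 : 0 <= (1 : R) <= 1 by rewrite ler01 lexx.
have := rP _ (tr 1 o01); rewrite scale1r => -[h1 k1 _].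
split=> //.
- have [] := @rdist_segment _ _ M h p (s *: (v : 'rV[R]_m)) (s * (tnorm v + eps)) ah.
  + by move=> t /tr/rP[].
  + move=> t /tr/rP[ht _ St]; rewrite (coord_vectorZ _ _ ah (cinv_dom ht)).
    apply: (le_trans (_ : _ <= s * Num.sqrt (S (p + t *: (s *: (v : 'rV[R]_m)))))).
      by rewrite tnormZ (gtr0_norm s0).
    exact: (ler_wpM2l (ltW s0) (ltW St)).
  move=> cs; rewrite (cmapK hx) => /rdist_le_length; exact: le_trans.
- have Fp : F p = cmap k (pi x) by rewrite /F /p /= (cmapK hx).
  rewrite -Fp.
  have : `|F (p + s *: (v : 'rV[R]_m)) - F p - (s - 0) *: e| <= eps * (s - 0).
    by near: s.
  by rewrite subr0.
Unshelve. all: by end_near. Qed.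

End lift.

(** * Distance between fibers *)

Section fibers.
Context (R : realType) (m n : nat) (M : riemannianManifold R m).
Context (B : riemannianManifold R n) (pi : M -> B).
Hypotheses (M_complete : complete_dist (@rdist R m M)).
Hypotheses (pi_smooth : smooth_map pi) (pi_rank : maximal_rank pi).
Variables (alpha beta : R).
Hypothesis alpha_ge1 : 1 <= alpha.
Hypothesis lift_bound : forall (x : M) (w : tangent (pi x)) (v : tangent x),
  horizontal_lift w v -> tnorm v <= alpha * tnorm w + beta.

(* Horizontal lifting is homogeneous, so the additive constant disappears. *)
Lemma lift_bound_linear (x : M) (w : tangent (pi x)) (v : tangent x) :
  horizontal_lift w v -> tnorm v <= alpha * tnorm w.
Proof.
move=> [hv Tv].
have bt (t : R) : 0 < t -> t * tnorm v <= alpha * (t * tnorm w) + beta.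
  move=> t0; have [Ev Ew] := (tnormZ x t v, tnormZ (pi x) t w).
  rewrite -[X in X * tnorm v](gtr0_norm t0) -[X in X * tnorm w](gtr0_norm t0).
  rewrite -Ev -Ew; apply: lift_bound; split.
    by move=> u /hv uv; rewrite Defs.metric_sym metricZl Defs.metric_sym uv mulr0.
  have dF := map_differentiable pi_smooth (chart_at_atlas x)
    (chart_at_atlas (pi x)) (chart_at_dom x) (chart_at_dom (pi x)).
  rewrite -Tv /tangent_map (deriveE _ dF) linearZ; congr (_ *: _).
  exact/esym/deriveE.
rewrite leNgt; apply/negP => lt.
have d0 : 0 < tnorm v - alpha * tnorm w by rewrite subr_gt0.
have b0 : 0 < `|beta| + 1 by rewrite ltr_wpDl.
(* This scaling factor turns the supposed excess of [tnorm v] into exactly [|beta| + 1], which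
   exceeds [beta]. *)
have := bt _ (divr_gt0 b0 d0).
rewrite mulrCA -lerBlDl -mulrBr divfK ?gt_eqF// => h.
by have := le_trans h (ler_norm beta); rewrite gerDl ler10.
Qed.

Lemma local_fiber_reach (y0 : B) : exists (K : R) (U : set B), nbhs y0 U /\
  forall x b, U (pi x) -> U b -> exists2 x', pi x' = b & rdist x x' <= K.
Proof.
pose k := chart_at y0; have ak : atlas k := chart_at_atlas y0.
have ky0 : dom k y0 := chart_at_dom y0.
pose p := cmap k y0; have kp : img k p := cmap_img ky0.
have [C C0 nC] := chart_norm_equiv ak kp.
have [r /= r0 rC] : exists2 r : R, 0 < r & forall q, `|q - p| < r ->
    img k q /\ forall u, tnorm (coord_vector k (cinv k q) u) <= C * `|u|.
  have : \forall q \near p, img k q /\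
      forall u, tnorm (coord_vector k (cinv k q) u) <= C * `|u|.
    near=> q; split; first by near: q; exact: chart_nbhs_img.
    have H : forall u, `|u| <= C * tnorm (coord_vector k (cinv k q) u) /\
       tnorm (coord_vector k (cinv k q) u) <= C * `|u| by near: q.
    by move=> u; exact: (H u).2.
  by move=> /nbhs_normP[r /= r0 H]; exists r => // q; rewrite distrC; exact: H.
(* Two points within [r / 4] of [p] are less than [r / 2] apart, so the ball around [cmap k b]
   through the starting point stays within [r] of [p]: the descent never leaves the good part of the
   chart. *)
have r4 : 0 < r / 4 by lra.
have a0 : 0 < alpha := lt_le_trans ltr01 alpha_ge1.
have aC : 0 < 2 * (alpha * C + 1) by rewrite mulr_gt0// addr_gt0// mulr_gt0.
exists (2 * (alpha * C + 1) * r), [set y | dom k y /\ `|cmap k y - p| < r / 4].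
split.
  have nr : \forall q \near p, `|q - p| < r / 4.
    by apply/nbhs_normP; exists (r / 4) => // q; rewrite /= distrC.
  have nr' := chart_near_cmap ky0 nr.
  by near=> y; split; near: y; [exact: chart_nbhs_dom|exact: nr'].
move=> x0 b [kx0 x0r] [kb br].
pose phi x := `|cmap k (pi x) - cmap k b|.
pose S := [set x | dom k (pi x) /\ phi x <= phi x0].
have phi0 : phi x0 < r / 2.
  rewrite /phi -(subrKA p) (le_lt_trans (ler_normD _ _))//.
  rewrite [X in _ + X]distrC; lra.
have ball_sub q : `|q - cmap k b| <= phi x0 -> `|q - p| < r.
  move=> qb; rewrite -(subrKA (cmap k b)) (le_lt_trans (ler_normD _ _))//; lra.
have Scl (u : nat -> M) x : (forall i, S (u i)) ->
    (forall i j, (i <= j)%N -> phi (u j) <= phi (u i)) ->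
    (forall e : R, 0 < e -> exists N, forall i, (N <= i)%N -> rdist (u i) x < e) ->
    S x /\ forall i, phi x <= phi (u i).
  move=> Su phiu ux.
  suff H i : dom k (pi x) /\ phi x <= phi (u i).
    split; last by move=> i; exact: (H i).2.
    by split; [exact: (H 0%N).1|exact: le_trans (H 0%N).2 (Su 0%N).2].
  (* The projected sequence stays in the closed set [D] from index [i] on. Were [pi x] outside,
     [rdist_nbhs] would push late terms outside too. *)
  pose D := [set y | dom k y /\ `|cmap k y - cmap k b| <= phi (u i)].
  have Dcl : closed D.
    apply: chart_ball_closed; first exact: manifold_hausdorff.
    by move=> q qi; have [] := rC q (ball_sub _ (le_trans qi (Su i).2)).
  have [//|nD] := pselect (D (pi x)).
  have nD' : \forall y \near pi x, ~ D y.
    by apply: open_nbhs_nbhs; split=> //; exact: closed_openC.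
  have [d d0 dP] := rdist_nbhs (near_cvg (pi_smooth.1 x) nD').
  have [N HN] := ux d d0.
  have := HN (maxn N i) (leq_maxl _ _); rewrite rdist_sym => /dP[].
  by split; [exact: (Su _).1|exact/phiu/leq_maxr].
have Sstep x : S x -> 0 < phi x -> exists2 y, S y &
    phi y < phi x /\ rdist x y <= 2 * (alpha * C + 1) * (phi x - phi y).
  move=> [kx xx0] px.
  pose e := (phi x)^-1 *: (cmap k b - cmap k (pi x)).
  have e1 : `|e| = 1.
    rewrite normrZ normfV (gtr0_norm px) [X in _ * X]distrC -/(phi x).
    by rewrite mulVf ?gt_eqF.
  have [v Hv] := horizontal_lift_exists pi_smooth (coord_vector k (pi x) e) pi_rank.
  have tv : tnorm v <= alpha * C.
    apply: (le_trans (lift_bound_linear Hv)); rewrite ler_pM2l//.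
    have [_ /(_ e)] := rC (cmap k (pi x)) (ball_sub _ xx0).
    by rewrite e1 mulr1 (cmapK kx).
  (* With tolerance 1/2, [phi] drops by at least [s / 2] for a distance at most
     [s * (alpha * C + 1)]; the ratio is the Caristi constant. *)
  have h2 : (0 : R) < 1 / 2 by lra.
  (* Requiring [s < phi x] prevents overshooting the target [cmap k b]. *)
  have : \forall s \near (0 : R)^'+, [/\ 0 < s, s < phi x & exists y,
      [/\ rdist x y <= s * (tnorm v + 1 / 2), dom k (pi y) &
      `|cmap k (pi y) - cmap k (pi x) - s *: e| <= 1 / 2 * s]].
    have nst := horizontal_step pi_smooth h2 ak kx Hv.
    near=> s; split; last by near: s.
      by near: s; exact: nbhs_right_gt.
    by near: s; exact: nbhs_right_lt.
  move=> /filter_ex[s [s0 sx [y [xy ky ys]]]].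
  have py : phi y <= phi x - s / 2.
    have -> : phi y = `|(cmap k (pi y) - cmap k (pi x) - s *: e) +
        (cmap k (pi x) - cmap k b + s *: e)|.
      by rewrite /phi; congr (`| _ |); rewrite addrACA addNr addr0 subrKA.
    apply: (le_trans (ler_normD _ _)).
    have -> : cmap k (pi x) - cmap k b + s *: e =
        (1 - s / phi x) *: (cmap k (pi x) - cmap k b).
      rewrite scalerBl scale1r /e scalerA -(opprB (cmap k (pi x))) scalerN.
      by rewrite mulrC.
    rewrite normrZ ger0_norm; last by rewrite subr_ge0 ler_pdivrMr// mul1r ltW.
    rewrite -/(phi x) mulrBl divfK ?gt_eqF// mul1r; lra.
  exists y; first by split=> //; apply: le_trans py _; lra.
  split; first by apply: le_lt_trans py _; lra.
  have h1 : rdist x y <= s * (alpha * C + 1).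
    by apply: (le_trans xy); rewrite ler_pM2l//; lra.
  apply: (le_trans h1).
  have : s * (alpha * C + 1) <= 2 * (phi x - phi y) * (alpha * C + 1).
    by rewrite ler_wpM2r//; [rewrite addr_ge0// mulr_ge0// ltW|lra].
  by rewrite mulrAC.
have Sx0 : S x0 by split.
have [x' [kx' _] [px' dx']] := caristi (@rdistxx _ _ M) (@rdist_sym _ _ M)
  (@rdist_tri _ _ M) (@rdist_ge0 _ _ M) M_complete aC (fun x _ => normr_ge0 _)
  Scl Sstep Sx0.
exists x'.
  move/eqP: px'; rewrite normr_eq0 subr_eq0 => /eqP E.
  by rewrite -(cmapK kx') E (cmapK kb).
apply: (le_trans dx'); rewrite ler_pM2l//; apply: (le_trans (ltW phi0)); lra.
Unshelve. all: by end_near. Qed.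

(** Connectedness carries the local estimate from [b] to every fiber; the constant then depends on
    the fiber, and compactness makes it uniform. *)
Lemma fiber_reach (b : B) : compact [set: B] ->
  exists K : R, forall x, exists2 x', pi x' = b & rdist x x' <= K.
Proof.
move=> B_compact.
pose P (K : R) (y : B) :=
  forall x, pi x = y -> exists2 x', pi x' = b & rdist x x' <= K.
(* Asking for one constant near [y] makes [S] open at once and is the form needed by
   [compact_unif_bound]. *)
pose S := [set y : B | exists K, \forall z \near y, P K z].
have nS (y z : B) (U : set B) K : nbhs y U ->
    (forall x b, U (pi x) -> U b -> exists2 x', pi x' = b & rdist x x' <= K) ->
    U z -> S z -> S y.
  (* Move to the fiber over [z] at cost [K], then on to the fiber over [b] at cost [L]. *)
  move=> yU HU Uz [L /nbhs_singleton PL]; exists (K + L).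
  apply: filterS yU => z' Uz' x xz'.
  have Ux : U (pi x) by rewrite xz'.
  have [x1 x1z d1] := HU x z Ux Uz.
  have [x2 x2b d2] := PL x1 x1z.
  by exists x2 => //; apply: (le_trans (rdist_tri _ x1 _)); exact: lerD.
have ST : S = setT.
  apply: (riemannian_connected (r := B)).
  - have [K [U [bU HU]]] := local_fiber_reach b.
    exists b, K; apply: filterS (bU) => z Uz x xz.
    by apply: HU; [rewrite xz|exact: nbhs_singleton bU].
  - exists S; last by rewrite setTI.
    by rewrite openE => y [K /near_join PK]; apply: filterS PK => z; exists K.
  - exists S; last by rewrite setTI.
    rewrite -[S]setCK; apply: open_closedC; rewrite openE => y nSy.
    have [K [U [yU HU]]] := local_fiber_reach y.
    by apply: filterS (yU) => z Uz Sz; apply: nSy; exact: nS yU HU Uz Sz.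
have [K PK] : exists K : R, forall y, P K y.
  apply: (compact_unif_bound B_compact) => [K K' y KK' PK x xy|y].
    by have [x' x'b d] := PK x xy; exists x' => //; exact: le_trans KK'.
  by have : S y by rewrite ST.
by exists K => x; exact: (PK (pi x)).
Qed.

Lemma rdist_bounded (b : B) : compact [set: B] ->
  exists K : R, forall y, rdist y b <= K.
Proof.
move=> B_compact; apply: (compact_unif_bound B_compact).
  by move=> K K' y KK' /le_trans; apply.
move=> y; exists (1 + rdist y b); apply: filterS (near_rdist y ltr01) => z yz.
by apply: (le_trans (rdist_tri _ y _)); rewrite lerD2r rdist_sym.
Qed.

End fibers.

(** * The two rough isometries *)

(** Both maps of the theorem distort distances only additively, so the multiplicative constant can
    be 1. *)
Lemma rough_isometry_sub (R : realType) (X Y : Type) (dX : X -> X -> R)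
    (dY : Y -> Y -> R) (phi : X -> Y) (C K : R) : 0 <= C ->
  (forall p q, `|dX p q - dY (phi p) (phi q)| <= C) ->
  (forall q, exists p, dY q (phi p) <= K) ->
  rough_isometry dX dY phi.
Proof.
move=> C0 HC HK; split.
  exists 1, C; split=> // p q; rewrite invr1 !mul1r.
  have := HC p q; rewrite ler_norml; lra.
exists (`|K| + 1); first by rewrite ltr_wpDl.
move=> q; have [p pK] := HK q.
apply: (@le_lt_trans _ _ (dY q (phi p))%:E).
  by apply: ereal_inf_lbound; exists p.
by rewrite lte_fin (le_lt_trans pK)// (le_lt_trans (ler_norm K))// ltrDl.
Qed.

Theorem theorem4p2p1 (R : realType) (m n : nat)
  (M : riemannianManifold R m) (B : riemannianManifold R n) (pi : M -> B)
  (dim_le : (n <= m)%N)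
  (M_complete : complete_dist (@rdist R m M))
  (pi_onto : forall b : B, exists x : M, pi x = b)
  (pi_smooth : smooth_map pi)
  (pi_rank : maximal_rank pi)
  (B_compact : compact [set: B])
  (alpha beta : R) (alpha_ge1 : 1 <= alpha) (beta_gt0 : 0 < beta)
  (lift_bound : forall (x : M) (w : tangent (pi x)) (v : tangent x),
     horizontal_lift w v -> tnorm v <= alpha * tnorm w + beta) :
  (forall b : B,
     rough_isometry (induced_dist (f := pi) (b := b) (@rdist R m M))
                    (@rdist R m M)
                    (fun p : fiber pi b => sval p)) /\
  (forall b : B,
     roughly_isometric (@rdist R m M)
       (prod_dist (induced_dist (f := pi) (b := b) (@rdist R m M))
                  (@rdist R n B))).
Proof.
have reach b := fiber_reach M_complete pi_smooth pi_rank alpha_ge1 lift_bound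
  b B_compact.
split=> b; have [K HK] := reach b.
  apply: (@rough_isometry_sub _ _ _ _ _ _ 0 K) => //.
    by move=> p q; rewrite subrr normr0.
  by move=> x; have [x' x'b xx'] := HK x; exists (exist _ x' x'b).
have [D HD] := rdist_bounded b B_compact.
have near x : {p : fiber pi b | rdist x (sval p) <= K}.
  have /cid2[x' x'b xx'] := HK x; by exists (exist _ x' x'b).
pose F x := sval (near x); have FK x : rdist x (sval (F x)) <= K := svalP (near x).
have [x0 _] := pi_onto b.
have K0 : 0 <= K := le_trans (rdist_ge0 _ _) (FK x0).
(* As [B] has bounded diameter, a constant second coordinate is good enough; [F] picks a point of
   the fiber within [K]. *)
exists (fun x => (F x, b)).
(* Both endpoints move by at most [K]. A pair [(p, b')] is approximated by the image of [p], at
   distance at most [K] in the fiber and [D] in [B], and the l^2 norm is at most the sum. *)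
apply: (@rough_isometry_sub _ _ _ _ _ _ (K + K) (K + D)).
- exact: addr_ge0.
- move=> x y; rewrite /prod_dist /induced_dist /= rdistxx expr0n addr0.
  rewrite sqrtr_sqr (ger0_norm (rdist_ge0 _ _)).
  have := FK x; have := FK y; rewrite ler_norml.
  have := rdist_tri x (sval (F x)) y.
  have := rdist_tri (sval (F x)) (sval (F y)) y.
  have := rdist_tri (sval (F x)) x (sval (F y)).
  have := rdist_tri x y (sval (F y)).
  rewrite (rdist_sym (sval (F x)) x) (rdist_sym (sval (F y)) y); lra.
- move=> [p b']; exists (sval p); rewrite /prod_dist /induced_dist /=.
  have d0 := rdist_ge0 (sval p) (sval (F (sval p))).
  have d1 := rdist_ge0 b' b.
  have DK : 0 <= K + D by rewrite addr_ge0// (le_trans d1).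
  rewrite -[leRHS](ger0_norm DK) -sqrtr_sqr ler_wsqrtr//.
  apply: (@le_trans _ _ ((rdist (sval p) (sval (F (sval p))) + rdist b' b) ^+ 2)).
    rewrite sqrrD lerD2r lerDl pmulrn_lge0// mulr_ge0//.
  have le_KD := lerD (FK (sval p)) (HD b').
  by rewrite lerXn2r ?nnegrE// addr_ge0.
Qed.
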